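(* As $r \to \infty$, \[ f(r, C_6) \leq 2 r^{1/2} + o(r^{1/2}) \quad \text{and} \quad f(r, C_{10}) \leq 2 r^{2/3} + o(r^{2/3}). \]
   Context: Let $r,k$ be positive integers. A graph $G$ is an $(r,k)$-graph if $V(G)$ can be partitioned into sets $V_1,\dots,V_r$ with $|V_i| \le k$ for all $i$ such that for every pair $i \neq j$ in $[r]$ there is an edge of $G$ with one endpoint in $V_i$ and the other in $V_j$. For a graph $H$, $f(r,H)$ is the minimum $k$ such that there exists an $H$-free $(r,k)$-graph. $C_\ell$ denotes the cycle of length $\ell$. $o(g(r))$ denotes a quantity $h(r)$ with $h(r)/g(r)\to 0$ as $r\to\infty$. *)

(* Defs.v *)
From mathcomp Require Import all_boot all_order all_algebra.
From mathcomp Require Import all_classical all_reals all_analysis.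

Set Implicit Arguments.
Unset Strict Implicit.
Unset Printing Implicit Defensive.

(* Finite simple graphs. Finiteness is no restriction here: a graph whose
   vertex set is covered by r sets of size at most k is finite. *)
Record sgraph := SGraph {
  vertex :> finType;
  adj : rel vertex;
  adj_sym : symmetric adj;
  adj_irr : irreflexive adj }.

(* G contains a (not necessarily induced) copy of H. *)
Definition contains (G H : sgraph) : Prop :=
  exists phi : H -> G,
    injective phi /\ forall x y : H, adj x y -> adj (phi x) (phi y).

Definition is_free (H G : sgraph) : Prop := ~ contains G H.

Definition rk_graph (r k : nat) (G : sgraph) : Prop :=
  exists V : 'I_r -> {set G},
    [/\ \bigcup_(i < r) V i = [set: G]%SET,
        forall i j : 'I_r, i != j -> [disjoint V i & V j],
        forall i : 'I_r, #|V i| <= k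
      & forall i j : 'I_r, i != j ->
          exists x y : G, [/\ x \in V i, y \in V j & adj x y]].

Definition admissible (r : nat) (H : sgraph) (k : nat) : Prop :=
  0 < k /\ exists G : sgraph, rk_graph r k G /\ is_free H G.

(* The minimum of [admissible r H]; the value 0 is a junk value, taken only
   when no k is admissible; by [f_cycle_min] this does not occur for cycles
   and r > 0. *)
Definition f (r : nat) (H : sgraph) : nat :=
  match pselect (exists k, `[< admissible r H k >]) with
  | left ex => ex_minn ex
  | right _ => 0
  end.

(* [ordS] is the cyclic successor on 'I_l. The graph is the cycle of length l
   for l >= 3; the conjunct [i != j] only matters for l = 1. *)
Definition cycle_adj (l : nat) : rel 'I_l :=
  fun i j => (i != j) && ((j == ordS i) || (i == ordS j)).

Lemma cycle_adj_sym (l : nat) : symmetric (@cycle_adj l).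
Proof. by move=> i j; rewrite /cycle_adj eq_sym orbC. Qed.

Lemma cycle_adj_irr (l : nat) : irreflexive (@cycle_adj l).
Proof. by move=> i; rewrite /cycle_adj eqxx. Qed.

Definition cycle_graph (l : nat) : sgraph :=
  SGraph (@cycle_adj_sym l) (@cycle_adj_irr l).

Lemma f_min (r : nat) (H : sgraph) : (exists k, admissible r H k) ->
  admissible r H (f r H) /\ forall k, admissible r H k -> f r H <= k.
Proof.
move=> [k0 k0P]; rewrite /f; case: pselect => [ex|nex]; last first.
  by case: nex; exists k0; apply/asboolP.
case: ex_minnP => m /asboolP mP mmin; split=> // k kP.
by apply: mmin; apply/asboolP.
Qed.

Section Matching.
Variable r : nat.

Definition matching_adj : rel ('I_r * 'I_r) :=
  fun x y => (x.1 != x.2) && (y == (x.2, x.1)).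

Lemma matching_adj_sym : symmetric matching_adj.
Proof.
move=> [a b] [c d]; rewrite /matching_adj /= !xpair_eqE.
by apply/andP/andP => -[ab /andP[/eqP e1 /eqP e2]]; subst; rewrite !eqxx eq_sym.
Qed.

Lemma matching_adj_irr : irreflexive matching_adj.
Proof.
move=> [a b]; rewrite /matching_adj /= xpair_eqE.
by case: eqP => //= ab; case: eqP.
Qed.

Definition matching : sgraph := SGraph matching_adj_sym matching_adj_irr.

Lemma matching_rk : rk_graph r r matching.
Proof.
exists (fun i => [set x : 'I_r * 'I_r | x.1 == i]%SET); split.
- apply/setP => x; rewrite [RHS]inE; apply/bigcupP; exists x.1 => //.
  by rewrite inE.
- move=> i j ij; rewrite -setI_eq0; apply/eqP/setP => x; rewrite !inE.
  by apply/negP => /andP[/eqP xi /eqP xj]; rewrite -xi -xj eqxx in ij.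
- move=> i; rewrite -[X in _ <= X]card_ord -cardsT.
  rewrite -(card_in_imset (f := snd)) ?subset_leq_card //.
  by move=> [a b] [c d]; rewrite !inE /= => /eqP -> /eqP -> ->.
- by move=> i j ij; exists (i, j), (j, i); rewrite !inE /= /adj /= /matching_adj
    /= ij !eqxx.
Qed.

Lemma matching_free (l : nat) : 3 <= l -> is_free (cycle_graph l) matching.
Proof.
case: l => [//|[//|[//|l]]] _ [phi [inj hom]].
pose n := l.+3; have E (i j : 'I_n) : i != j -> j = ordS i ->
    phi j = ((phi i).2, (phi i).1).
  move=> ij ji; have /hom : @adj (cycle_graph n) i j.
    by rewrite /adj /= /cycle_adj ij ji eqxx.
  by rewrite /adj /= /matching_adj => /andP[_ /eqP].
pose o k (h : k < n) : 'I_n := Ordinal h.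
have e1 := E (@o 0 isT) (@o 1 isT) isT.
have e2 := E (@o 1 isT) (@o 2 isT) isT.
have {}e1 : phi (@o 1 isT) = ((phi (@o 0 isT)).2, (phi (@o 0 isT)).1).
  by apply: e1; apply: val_inj.
have {}e2 : phi (@o 2 isT) = ((phi (@o 1 isT)).2, (phi (@o 1 isT)).1).
  by apply: e2; apply: val_inj => /=; rewrite modn_small.
suff /inj : phi (@o 2 isT) = phi (@o 0 isT) by [].
by rewrite e2 e1 /=; case: (phi _).
Qed.

End Matching.

Lemma f_cycle_min (r l : nat) : 0 < r -> 3 <= l ->
  admissible r (cycle_graph l) (f r (cycle_graph l)) /\
  forall k, admissible r (cycle_graph l) k -> f r (cycle_graph l) <= k.
Proof.
move=> r0 l3; apply: f_min; exists r; split=> //; exists (matching r).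
by split; [exact: matching_rk|exact: matching_free].
Qed.

(* Main.v *)
(* C_{2k}-free graphs, k = 2e+1 = 3, 5.  In Wenger's graph points p and lines l
   range over F^k, with p incident to l iff p_j + l_j = p_0^j l_0 for 0 < j < k.
   Two lines through a point with first coordinate a differ by a multiple of
   (1, a, .., a^(k-1)), so a 2k-cycle gives a vanishing combination, with nonzero
   coefficients, of k vectors on the moment curve, cyclically consecutive ones
   being distinct.  By Vandermonde every vector must occur twice, which is
   impossible for k = 3, 5.  Fixing (p_0, p_{e+1}, .., p_{2e}) for points and
   (l_0, .., l_e) for lines determines exactly one incident pair; grouping by
   these data gives q^(e+1) parts of size 2q^e, any two of them joined by edges.

   To reach all r one needs, for each d > 0, a prime power in (x, e^d x] for all
   large x.  This follows from Selberg's formula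
     psi(x) ln x + sum_{n <= x} Lambda(n) psi(x/n) = 2 x ln x + O(x)
   by Erdos' argument.  The formula bounds the density of psi by 2 on every
   interval.  If (x, e^d x] carries mass o(x), then comparing the formula at x
   and e^d x shows that (x/n, e^d x/n] has density 2 for almost all n.  For d
   nearly maximal such n are found in every interval slightly longer than d (in
   log scale), and applying this twice produces density 2 on more than half of a
   long range, against Mertens' sum_{n <= x} Lambda(n)/n = ln x + O(1). *)

Require Import Defs.
From mathcomp Require Import all_boot all_order all_algebra all_field ring lra.
From mathcomp Require Import all_classical all_reals all_analysis.
Import Order.TTheory GRing.Theory Num.Theory.
Import numFieldNormedType.Exports.
Set Implicit Arguments.
Unset Strict Implicit.
Unset Printing Implicit Defensive.
Local Open Scope classical_set_scope.
Local Open Scope ring_scope.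

(** * The Wenger graph *)

Section MomentCurve.
Variables (F : fieldType) (k : nat) (t a : nat -> F).
Hypothesis moments : forall j, (j < k)%N -> \sum_(i < k) t i * a i ^+ j = 0.
Hypothesis t_neq0 : forall i, t i != 0.

(** Vandermonde without determinants: pair the moments with the coefficients of [P], which vanishes
    at the nodes of all other indices. Only the term [t i * P.[a i]] survives, so [a i] is a root of
    [P] and equals another node. *)
Lemma moment_partner i : (i < k)%N -> exists j, [/\ (j < k)%N, j != i & a j = a i].
Proof.
move=> ik; pose o := Ordinal ik.
have [/existsP[j /andP[ji /eqP ja]]|] :=
  boolP [exists j : 'I_k, (j != o) && (a j == a i)]; first by exists j; split.
rewrite negb_exists => /forallP H.
pose P := \prod_(j < k | j != o) ('X - (a j)%:P).
have sP : (size P <= k)%N.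
  apply: leq_trans (size_prod_leq _ _) _.
  under eq_bigr => l _ do rewrite size_XsubC.
  rewrite sum_nat_const cardC1 card_ord.
  by rewrite muln2 -addnn -addnS addKn prednK // (leq_ltn_trans _ ik).
have : \sum_(l < k) t l * P.[a l] = 0.
  under eq_bigr => l _ do rewrite (horner_coef_wide _ sP) mulr_sumr.
  rewrite exchange_big big1 //= => j _.
  under eq_bigr => l _ do rewrite mulrCA.
  by rewrite -mulr_sumr moments ?mulr0.
rewrite (bigD1 o) //= big1 ?addr0 => [|l lo]; last first.
  by rewrite /P (bigD1 l) //= hornerM hornerXsubC subrr mul0r mulr0.
move/eqP; rewrite mulf_eq0 (negPf (t_neq0 _)) /= /P horner_prod.
move=> /prodf_eq0[j jo]; rewrite hornerXsubC subr_eq0 => /eqP aj.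
by have := H j; rewrite jo aj eqxx.
Qed.

Hypothesis a_step : forall i, a i != a i.+1.
Hypothesis a_period : a k = a 0%N.

(** The indices sharing a value of [a] form an independent set of the cycle of length [k], with at
    least two elements. For [k = 3] independent sets are singletons; for [k = 5] they have at most
    two elements, and 5 is odd. *)
Lemma no_moment_cycle : k = 3 \/ k = 5 -> False.
Proof.
have part := moment_partner; have per := a_period; have s := a_step.
case=> kE; rewrite kE in part per.
  have [j [+ +]] := part 1%N isT; case: j => [|[|[|j]]] // _ _ e.
    by have := s 0%N; rewrite e eqxx.
  by have := s 1%N; rewrite e eqxx.
have neq i : a i = a i.+1 -> False by move=> e; have := s i; rewrite e eqxx.
have n40 : a 4 = a 0%N -> False by rewrite -per; exact: neq.
have [j [+ +]] := part 0%N isT; case: j => [|[|[|[|[|j]]]]] // _ _ e0.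
- by apply: (neq 0%N).
- have [j [+ +]] := part 3 isT; case: j => [|[|[|[|[|j]]]]] // _ _ e3.
  + by apply: (neq 2); rewrite e0.
  + have [j [+ +]] := part 4 isT; case: j => [|[|[|[|[|j]]]]] // _ _ e4.
    * by apply: n40.
    * by apply: (neq 3); rewrite -e3.
    * by apply: n40; rewrite -e4.
    * by apply: (neq 3).
  + by apply: (neq 2).
  + by apply: (neq 3).
- have [j [+ +]] := part 2 isT; case: j => [|[|[|[|[|j]]]]] // _ _ e2.
  + by apply: (neq 2); rewrite -e2 e0.
  + by apply: (neq 1%N).
  + by apply: (neq 2).
  + have [j [+ +]] := part 1%N isT; case: j => [|[|[|[|[|j]]]]] // _ _ e1.
    * by apply: (neq 0%N).
    * by apply: (neq 1%N).
    * by apply: (neq 0%N); rewrite -e0.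
    * by apply: (neq 1%N); rewrite -e1.
Qed.

End MomentCurve.

Section Wenger.
Variables (F : finFieldType) (e r : nat) (iota : 'I_r -> e.+1.-tuple F).
Hypothesis iota_inj : injective iota.

(* A vertex consists of its part, its side (true for points) and the e
   coordinates that its part does not determine. *)
Definition wvertex := ('I_r * bool * e.-tuple F)%type.

Definition is_point (v : wvertex) := v.1.2.

Definition coords (v : wvertex) : seq F :=
  if is_point v then head 0 (iota v.1.1) :: v.2 ++ behead (iota v.1.1)
  else iota v.1.1 ++ v.2.

Definition incident (p l : wvertex) : bool :=
  [forall j : 'I_(e + e).+1, (j == 0 :> nat) ||
    ((coords p)`_j + (coords l)`_j == (coords p)`_0 ^+ j * (coords l)`_0)].

Definition wadj : rel wvertex := fun u v =>
  (is_point u != is_point v) && (if is_point u then incident u v else incident v u).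

Lemma wadj_sym : symmetric wadj.
Proof. by move=> u v; rewrite /wadj eq_sym; case: (is_point u); case: (is_point v). Qed.

Lemma wadj_irr : irreflexive wadj.
Proof. by move=> u; rewrite /wadj eqxx. Qed.

Definition wenger : sgraph := SGraph wadj_sym wadj_irr.

Lemma size_coords v : size (coords v) = (e + e).+1.
Proof.
rewrite /coords; case: ifP => _ /=; rewrite size_cat ?size_behead !size_tuple //.
Qed.

Lemma coords_inj u v : is_point u = is_point v -> coords u = coords v -> u = v.
Proof.
case: u v => [[i b] t] [[i' b'] t']; rewrite /coords /is_point /= => <-.
case: b => [[h]|] /eqP.
  rewrite eqseq_cat ?size_tuple // => /andP[/eqP/val_inj -> /eqP hb].
  suff /iota_inj -> : iota i = iota i' by [].
  apply: val_inj; move: h hb.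
  by case: (iota i) (iota i') => [[|x s] //= _] [[|y s'] //= _] -> ->.
rewrite eqseq_cat ?size_tuple // => /andP[/eqP/val_inj/iota_inj -> /eqP/val_inj ->].
by [].
Qed.

Lemma incidentP p l j : incident p l -> (0 < j <= e + e)%N ->
  (coords p)`_j + (coords l)`_j = (coords p)`_0 ^+ j * (coords l)`_0.
Proof.
move=> /forallP H /andP[j0 je]; have := H (Ordinal (je : (j < (e + e).+1)%N)) => /=.
by rewrite eqn0Ngt j0 => /eqP.
Qed.

Lemma incident_point_inj p p' l : is_point p = is_point p' ->
  incident p l -> incident p' l -> (coords p)`_0 = (coords p')`_0 -> p = p'.
Proof.
move=> pp pl pl' e0; apply: coords_inj => //.
apply: (@eq_from_nth _ 0) => [|[|j]]; rewrite !size_coords // => je.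
apply: (addIr (coords l)`_j.+1).
by rewrite (@incidentP _ _ j.+1 pl je) (@incidentP _ _ j.+1 pl' je) e0.
Qed.

Lemma incident_line_inj p l l' : is_point l = is_point l' ->
  incident p l -> incident p l' -> (coords l)`_0 = (coords l')`_0 -> l = l'.
Proof.
move=> pp pl pl' e0; apply: coords_inj => //.
apply: (@eq_from_nth _ 0) => [|[|j]]; rewrite !size_coords // => je.
apply: (addrI (coords p)`_j.+1).
by rewrite (@incidentP _ _ j.+1 pl je) (@incidentP _ _ j.+1 pl' je) e0.
Qed.

(** The system is diagonal in the free coordinates: equation [j] contains only the point's [p_j]
    when [j <= e], and only the line's [l_j] when [j > e]. *)
Lemma classes_incident (i i' : 'I_r) : exists t t',
  incident (i, true, t) (i', false, t').
Proof.
pose c := iota i; pose c' := iota i'.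
have mk (h : nat -> F) : exists t : e.-tuple F, forall k, (k < e)%N -> t`_k = h k.
  by exists [tuple h k | k < e] => k ke; have := nth_mktuple (fun k : 'I_e => h k) 0 (Ordinal ke).
have [t tE] := mk (fun k => c`_0 ^+ k.+1 * c'`_0 - c'`_k.+1).
have [t' tE'] := mk (fun k => c`_0 ^+ (e + k).+1 * c'`_0 - c`_k.+1).
exists t, t'; apply/forallP => -[[|j] je] //=.
rewrite /coords /is_point /= -/c -/c' -nth0 !nth_cat /= !size_tuple /= ltnS.
case: ltnP => [je'|ej]; first by rewrite tE // subrK.
have je' : (j - e < e)%N by rewrite ltn_subLR.
by rewrite subSS tE' // nth_behead subnKC // addrC subrK.
Qed.

Lemma wenger_rk : rk_graph r (2 * #|F| ^ e) wenger.
Proof.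
exists (fun i => [set v : wvertex | v.1.1 == i]%SET); split.
- by apply/setP => v; rewrite inE; apply/bigcupP; exists v.1.1; rewrite ?inE.
- move=> i j ij; rewrite -setI_eq0; apply/eqP/setP => v; rewrite !inE.
  by apply/negP => /andP[/eqP vi /eqP vj]; rewrite -vi -vj eqxx in ij.
- move=> i; rewrite -(card_tuple e) -card_bool -card_prod.
  rewrite -(@card_in_imset _ _ (fun v : wvertex => (v.1.2, v.2))) ?max_card //.
  by move=> [[? ?] ?] [[? ?] ?]; rewrite !inE /= => /eqP -> /eqP -> [-> ->].
- move=> i j ij; have [t [t' H]] := classes_incident i j.
  by exists (i, true, t), (j, false, t'); rewrite !inE /= /adj /= /wadj /is_point /= H !eqxx.
Qed.

Lemma wenger_free : e = 1%N \/ e = 2 -> is_free (cycle_graph (2 * (e + e).+1)) wenger.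
Proof.
move=> e12 [phi [inj hom]]; pose k := (e + e).+1; pose M := (2 * k)%N.
have k2 : (2 < k)%N by rewrite /k; case: e12 => ->.
have M4 : (4 < M)%N by rewrite /M mul2n -addnn (@leq_add 3 2) // ltnW.
have M0 : (0 < M)%N by exact: leq_trans M4.
(* The cycle is unrolled to a walk [g] over all of [nat] with period [M], so that indices never wrap
   around. *)
pose o n : 'I_M := Ordinal (ltn_pmod n M0); pose g n : wvertex := phi (o n).
have gE m n : g m = g n -> m = n %[mod M] by move=> /inj [].
have gM n : g (n + M)%N = g n by congr (phi _); apply: val_inj; rewrite /= modnDr.
have g_neq n d : (0 < d < M)%N -> g n <> g (n + d)%N.
  move=> /andP[d0 dM] /gE /eqP; rewrite -{1}[n]addn0 eqn_modDl mod0n eq_sym.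
  by rewrite modn_small // eqn0Ngt d0.
have gadj n : wadj (g n) (g n.+1).
  apply: (hom (o n) (o n.+1)); rewrite /adj /= /cycle_adj; apply/andP; split.
    apply/eqP => oo; apply: (@g_neq n 1%N); first by rewrite /= (ltn_trans _ M4).
    by rewrite addn1 /g oo.
  apply/orP; left; apply/eqP/val_inj; rewrite /= -addn1 -[in RHS]addn1 modnDml //.
have gside n : is_point (g n.+1) = ~~ is_point (g n).
  by have /andP[] := gadj n; case: (is_point _); case: (is_point _).
(* The shift [s] makes the walk start at a line; from there lines and points alternate. *)
pose s := nat_of_bool (is_point (g 0%N)).
have lineP i : is_point (g (s + i.*2)%N) = false.
  elim: i => [|i IH]; last by rewrite doubleS !addnS !gside negbK.
  by rewrite addn0 /s; case E : (is_point (g 0%N)); rewrite //= gside E.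
pose line i := g (s + i.*2)%N; pose pt i := g (s + i.*2).+1%N.
have inc1 i : incident (pt i) (line i).
  have /andP[_] := gadj (s + i.*2)%N; by rewrite lineP.
have inc2 i : incident (pt i) (line i.+1).
  have /andP[_] := gadj (s + i.*2).+1%N; by rewrite gside lineP /= /line doubleS !addnS.
have side_pt i : is_point (pt i) by rewrite gside lineP.
pose a i := (coords (pt i))`_0; pose t i := (coords (line i.+1))`_0 - (coords (line i))`_0.
(* Subtracting the incidences of [pt i] with its two neighbouring lines cancels the point's own
   coordinate. Summed around the cycle, the right-hand sides telescope to 0. *)
have line_step i j : (j < k)%N ->
    t i * a i ^+ j = (coords (line i.+1))`_j - (coords (line i))`_j :> F.
  case: j => [|j] jk; first by rewrite expr0 mulr1.
  have := @incidentP _ _ j.+1 (inc2 i) jk; have := @incidentP _ _ j.+1 (inc1 i) jk.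
  move=> /(canRL (addKr _)) -> /(canRL (addKr _)) ->.
  by rewrite /t /a mulrC mulrBr opprD opprK addrACA addNr add0r.
apply: (@no_moment_cycle F k t a); last by rewrite /k; case: e12 => ->; [left|right].
- move=> j jk; under eq_bigr => i _ do rewrite line_step //.
  rewrite -(big_mkord xpredT (fun i => (coords (line i.+1))`_j - (coords (line i))`_j)).
  rewrite telescope_sumr // (_ : line k = line 0%N) ?subrr //.
  by rewrite /line addn0 -[in LHS]mul2n gM.
- move=> i; rewrite subr_eq0; apply/eqP => ll.
  have sl := etrans (lineP i) (esym (lineP i.+1)).
  have := incident_line_inj sl (inc1 i) (inc2 i) (esym ll).
  rewrite /line doubleS !addnS -addn2; apply: g_neq.
  by rewrite /= (ltn_trans _ M4).
- move=> i; apply/eqP => ll.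
  have sp : is_point (pt i) = is_point (pt i.+1) by rewrite !side_pt.
  have := incident_point_inj sp (inc2 i) (inc1 i.+1) ll.
  rewrite /pt doubleS !addnS -addn2; apply: g_neq.
  by rewrite /= (ltn_trans _ M4).
- by rewrite /a /pt -[in LHS]mul2n -addSn gM addn0.
Qed.

End Wenger.

(** Any [r] of the [#|F| ^ e.+1] possible parts still have an edge between every two of them, so [r]
    may lie below the exact power. *)
Lemma f_cycle_le (F : finFieldType) (e r : nat) : e = 1%N \/ e = 2 ->
  (r <= #|F| ^ e.+1)%N -> (f r (cycle_graph (2 * (e + e).+1)) <= 2 * #|F| ^ e)%N.
Proof.
move=> e12 rF; have rF' : (r <= #|{: e.+1.-tuple F}|)%N by rewrite card_tuple.
pose iota (i : 'I_r) : e.+1.-tuple F := enum_val (widen_ord rF' i).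
have iota_inj : injective iota.
  by move=> i j /enum_val_inj /(congr1 val) ij; apply: val_inj.
have adm : admissible r (cycle_graph (2 * (e + e).+1)) (2 * #|F| ^ e).
  split; first by rewrite muln_gt0 expn_gt0 (ltn_trans _ (finNzRing_gt1 F)).
  exists (wenger iota); split; first exact: wenger_rk.
  exact: wenger_free.
by have [_] := f_min (ex_intro _ _ adm); apply.
Qed.

(** * The Moebius and von Mangoldt functions *)

Section Arithmetic.
Context {R : realType}.

Definition moebius (n : nat) : R :=
  \prod_(p <- primes n) (if logn p n == 1 then -1 else 0).

Definition mangoldt (n : nat) : R :=
  if primes n is [:: p] then ln p%:R else 0.

Lemma norm_moebius_le1 n : `|moebius n| <= 1.
Proof.
rewrite /moebius normr_prod; elim: (primes n) => [|p s IH]; first by rewrite big_nil.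
rewrite big_cons; apply: mulr_ile1 => //; try exact: prodr_ge0.
by case: ifP; rewrite ?normrN1 ?normr0.
Qed.

Lemma moebius1 : moebius 1 = 1.
Proof. by rewrite /moebius big_nil. Qed.

Lemma moebius_primeM p m : prime p -> (0 < m)%N -> ~~ (p %| m)%N ->
  moebius (p * m) = - moebius m.
Proof.
move=> pp m0 pm; have p0 := prime_gt0 pp.
have pnm : p \notin primes m by rewrite mem_primes pp m0.
rewrite /moebius (perm_big (p :: primes m)) /=; last first.
  apply: uniq_perm; rewrite /= ?primes_uniq ?pnm // => q.
  by rewrite inE primesM // primes_prime // inE.
rewrite big_cons lognM // logn_prime // eqxx lognE pp m0 (negPf pm) /= mulN1r.
congr (- _); apply: eq_big_seq => q qm; rewrite lognM // logn_prime //.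
by case: (eqVneq q p) qm => [->|_ //]; rewrite (negPf pnm).
Qed.

Lemma moebius_sq_dvd p n : prime p -> (0 < n)%N -> (p ^ 2 %| n)%N -> moebius n = 0.
Proof.
move=> pp n0 p2n.
have pn : p \in primes n.
  by rewrite mem_primes pp n0 (dvdn_trans _ p2n) // dvdn_exp.
rewrite /moebius (bigD1_seq p) //= ?primes_uniq //; case: eqP => [e|]; last by rewrite mul0r.
by move: p2n; rewrite pfactor_dvdn // e.
Qed.

(** For a prime [p] dividing [n], divisors divisible by [p ^ 2] contribute 0, and the others cancel
    in pairs [d], [p * d] with [p] not dividing [d]. *)
Lemma sum_moebius_divisors n : (0 < n)%N ->
  \sum_(d <- divisors n) moebius d = (n == 1)%:R.
Proof.
move=> n0; case: (ltngtP n 1) => n1; last 1 first.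
- by rewrite n1 /= (_ : divisors 1 = [:: 1%N]) // big_seq1 moebius1.
- by move: n1; rewrite ltnS leqn0 => /eqP n1; rewrite n1 in n0.
pose p := pdiv n; have pp : prime p by exact: pdiv_prime.
have pn : (p %| n)%N by exact: pdiv_dvd.
rewrite (bigID (fun d => (p %| d)%N)) /= (bigID (fun d => (p ^ 2 %| d)%N)) /=.
rewrite big_seq_cond big1 ?add0r; last first.
  move=> d; rewrite -dvdn_divisors // => /andP[dn /andP[_ p2d]].
  by apply: (moebius_sq_dvd pp) => //; exact: dvdn_gt0 dn.
rewrite -big_filter (perm_big [seq (p * d)%N | d <- divisors n & ~~ (p %| d)%N]).
  rewrite big_map big_filter -big_split big_seq_cond big1 //= => d.
  rewrite -dvdn_divisors // => /andP[dn pd].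
  by rewrite moebius_primeM ?addNr //; exact: dvdn_gt0 dn.
have p0 := prime_gt0 pp.
apply: uniq_perm; first by rewrite filter_uniq ?divisors_uniq.
  rewrite map_inj_uniq ?filter_uniq ?divisors_uniq // => a b /eqP.
  by rewrite eqn_pmul2l // => /eqP.
move=> d; rewrite mem_filter; apply/idP/mapP => [|[e + ->]].
  rewrite -dvdn_divisors // => /andP[/andP[/dvdnP[e ->] p2] dn].
  exists e; rewrite 1?mulnC // mem_filter -dvdn_divisors //.
  rewrite (dvdn_trans _ dn) ?dvdn_mulr // andbT.
  by apply: contra p2 => pe; rewrite expnS expn1 dvdn_mul.
rewrite mem_filter -!dvdn_divisors // => /andP[pe en].
rewrite dvdn_mulr //= expnS expn1 dvdn_pmul2l // pe /=.
by rewrite Gauss_dvd ?pn ?en // prime_coprime.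
Qed.

Lemma mangoldt_ge0 n : 0 <= mangoldt n.
Proof.
rewrite /mangoldt; case e : (primes n) => [//|p [|//]].
have : p \in primes n by rewrite e inE.
rewrite mem_primes => /andP[pp _]; apply: ln_ge0.
by rewrite ler1n prime_gt0.
Qed.

Lemma mangoldt_neq0 n : mangoldt n != 0 ->
  exists p k, [/\ prime p, (0 < k)%N & n = (p ^ k)%N].
Proof.
rewrite /mangoldt; case e : (primes n) => [|p [|? ?]]; rewrite ?eqxx // => _.
have : p \in primes n by rewrite e inE.
move=> pn; have := pn; rewrite mem_primes => /and3P[pp n0 pdn].
exists p, (logn p n); split => //; first by rewrite logn_gt0.
by rewrite {1}(prod_prime_decomp n0) prime_decompE e /= big_seq1.
Qed.

Lemma mangoldt_primeX p k : prime p -> (0 < k)%N -> mangoldt (p ^ k) = ln p%:R.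
Proof. by move=> pp k0; rewrite /mangoldt primesX // primes_prime. Qed.

(** Induction from [m = n / p] to [n]: a divisor of [n] that does not divide [m] contains the full
    power of [p] in [n], so that power is the only prime power among the new divisors, and it adds
    [ln p]. *)
Lemma sum_mangoldt_divisors n : (0 < n)%N ->
  \sum_(d <- divisors n) mangoldt d = ln n%:R.
Proof.
elim/ltn_ind: n => n IH n0; case: (ltngtP n 1) => n1; last 1 first.
- by rewrite n1 (_ : divisors 1 = [:: 1%N]) // big_seq1 ln1.
- by move: n1; rewrite ltnS leqn0 => /eqP n1; rewrite n1 in n0.
pose p := pdiv n; have pp : prime p by exact: pdiv_prime.
have [m nE] : exists m, n = (m * p)%N by apply/dvdnP; exact: pdiv_dvd.
have p0 := prime_gt0 pp; have p1 := prime_gt1 pp.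
have m0 : (0 < m)%N by move: n0; rewrite nE muln_gt0 => /andP[].
have mn : (m %| n)%N by rewrite nE dvdn_mulr.
rewrite (bigID (fun d => (d %| m)%N)) /= -big_filter.
rewrite (perm_big (divisors m)) /=; last first.
  apply: uniq_perm; rewrite ?filter_uniq ?divisors_uniq // => d.
  rewrite mem_filter -!dvdn_divisors //; case: (boolP (_ %| m)%N) => //= dm.
  exact: dvdn_trans dm mn.
rewrite IH //; last by rewrite nE ltn_Pmulr.
pose a := logn p n; have aE : a = (logn p m).+1.
  by rewrite /a nE lognM // (logn_prime _ pp) eqxx addn1.
rewrite -big_filter (bigD1_seq (p ^ a)%N) ?filter_uniq ?divisors_uniq //=; last first.
  rewrite mem_filter -dvdn_divisors // pfactor_dvdnn andbT.
  by rewrite pfactor_dvdn // -/a aE ltnn.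
rewrite mangoldt_primeX //; last by rewrite aE.
rewrite big_filter_cond big_seq_cond big1 ?addr0; last first.
  move=> d; rewrite -dvdn_divisors // => /and3P[dn dm da].
  apply/eqP/negPn/negP => /mangoldt_neq0[q [k [pq k0 dE]]]; subst d.
  case: (eqVneq q p) => [qp|qp].
    subst q; move: dn dm da; rewrite !pfactor_dvdn // -/a => ka.
    rewrite -ltnNge => ak.
    by have /eqP -> : k == a; [rewrite eqn_leq ka aE|rewrite eqxx].
  move: dn dm; rewrite nE Gauss_dvdl; first by move=> ->.
  by rewrite coprimeXl // prime_coprime // dvdn_prime2.
by rewrite nE natrM lnM // posrE ltr0n.
Qed.

Lemma sum_divisorsC n (f : nat -> nat -> R) : (0 < n)%N ->
  \sum_(d <- divisors n) f d (n %/ d)%N = \sum_(d <- divisors n) f (n %/ d)%N d.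
Proof.
move=> n0; rewrite [RHS](perm_big [seq (n %/ d)%N | d <- divisors n]).
  rewrite big_map; apply: eq_big_seq => d; rewrite -dvdn_divisors // => dn.
  by rewrite divnA // mulKn.
have inv d : (d %| n)%N -> (n %/ (n %/ d) = d)%N.
  by move=> dn; rewrite divnA // mulKn.
apply: uniq_perm; rewrite ?divisors_uniq // ?map_inj_in_uniq ?divisors_uniq //.
  move=> a b; rewrite -!dvdn_divisors // => an bn /(congr1 (divn n)).
  by rewrite !inv.
move=> d; apply/idP/mapP => [|[e + ->]]; rewrite -!dvdn_divisors //.
  move=> dn; exists (n %/ d)%N; rewrite ?inv // -dvdn_divisors //.
  by rewrite dvdn_div.
by move=> en; rewrite dvdn_div.
Qed.

(** Both sides run over the pairs with [d * m <= N]; on the right they are grouped by the product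
    [k]. *)
Lemma sum_hyperbola N (f : nat -> nat -> R) :
  \sum_(1 <= d < N.+1) \sum_(1 <= m < (N %/ d).+1) f d m =
  \sum_(1 <= k < N.+1) \sum_(d <- divisors k) f d (k %/ d)%N.
Proof.
elim: N => [|N IH]; first by rewrite !big_geq.
rewrite [RHS]big_nat_recr //= -IH.
transitivity (\sum_(1 <= d < N.+2) (\sum_(1 <= m < (N %/ d).+1) f d m +
   (d %| N.+1)%:R * f d (N.+1 %/ d)%N)).
  apply: eq_big_nat => d /andP[d1 _]; rewrite divnS //.
  case: (boolP (_ %| _)%N) => dN; rewrite ?add1n ?add0n ?mul1r ?mul0r ?addr0 //.
  by rewrite big_nat_recr.
rewrite big_split big_nat_recr //= divn_small // (@big_geq _ _ _ 1 1) // addr0.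
congr (_ + _).
rewrite [RHS](perm_big [seq d <- index_iota 1 N.+2 | (d %| N.+1)%N]); last first.
  apply: uniq_perm; rewrite ?divisors_uniq ?filter_uniq ?iota_uniq // => d.
  rewrite mem_filter -dvdn_divisors // mem_index_iota.
  case: (boolP (_ %| _)%N) => //= dN.
  by rewrite (dvdn_gt0 _ dN) // ltnS dvdn_leq.
rewrite [RHS]big_filter [RHS]big_mkcond /=; apply: eq_bigr => d _.
by case: ifP; rewrite ?mul1r ?mul0r.
Qed.

End Arithmetic.

(** * Sums over the positive integers up to a real bound, and Moebius inversion *)

Notation "\ssum_ ( i <= x ) F" := (\sum_(1 <= i < (Num.truncn x).+1) F)
  (at level 41, F at level 41, i name, x at level 69,
   format "'[' \ssum_ ( i  <=  x ) '/  '  F ']'") : ring_scope.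

Section SumsUpToReal.
Context {R : realType}.
Implicit Types x y : R.

Lemma mem_ssum x n : 0 <= x -> (1 <= n < (Num.truncn x).+1)%N = (0 < n)%N && (n%:R <= x).
Proof. by move=> x0; rewrite ltnS truncn_ge_nat. Qed.

Lemma truncn_div x d : 0 <= x -> (0 < d)%N ->
  Num.truncn (x / d%:R) = (Num.truncn x %/ d)%N.
Proof.
move=> x0 d0; have d0' : 0 < d%:R :> R by rewrite ltr0n.
have /andP[le lt] := truncn_itv x0.
apply: truncn_def; rewrite ler_pdivlMr // ltr_pdivrMr // -!natrM.
rewrite (le_trans _ le) ?ler_nat ?leq_trunc_div //.
by rewrite (lt_le_trans lt) // ler_nat ltn_ceil.
Qed.

Lemma eq_ssum x (F G : nat -> R) : 0 <= x ->
  (forall n, (0 < n)%N -> n%:R <= x -> F n = G n) ->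
  \ssum_(n <= x) F n = \ssum_(n <= x) G n.
Proof.
move=> x0 FG; apply: eq_big_nat => n.
by rewrite mem_ssum // => /andP[n0 nx]; exact: FG.
Qed.

Lemma ler_ssum x (F G : nat -> R) : 0 <= x ->
  (forall n, (0 < n)%N -> n%:R <= x -> F n <= G n) ->
  \ssum_(n <= x) F n <= \ssum_(n <= x) G n.
Proof.
move=> x0 FG; apply: ler_sum_nat => n.
by rewrite mem_ssum // => /andP[n0 nx]; exact: FG.
Qed.

Lemma ler_norm_ssum x (F G : nat -> R) : 0 <= x ->
  (forall n, (0 < n)%N -> n%:R <= x -> `|F n| <= G n) ->
  `|\ssum_(n <= x) F n| <= \ssum_(n <= x) G n.
Proof. by move=> x0 FG; apply: le_trans (ler_norm_sum _ _ _) _; exact: ler_ssum. Qed.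

Lemma ssum_hyperbola x (f : nat -> nat -> R) : 0 <= x ->
  \ssum_(d <= x) \ssum_(m <= x / d%:R) f d m =
  \ssum_(k <= x) \sum_(d <- divisors k) f d (k %/ d)%N.
Proof.
move=> x0; rewrite -sum_hyperbola; apply: eq_ssum => // d d0 _.
by rewrite truncn_div.
Qed.

Lemma ssum_mul_div x (g : nat -> R) (F : R -> R) : 0 <= x ->
  \ssum_(d <= x) (g d * \ssum_(m <= x / d%:R) F (x / d%:R / m%:R)) =
  \ssum_(k <= x) ((\sum_(d <- divisors k) g d) * F (x / k%:R)).
Proof.
move=> x0.
rewrite (eq_bigr (fun d => \ssum_(m <= x / d%:R) (g d * F (x / d%:R / m%:R)))); last first.
  by move=> d _; rewrite mulr_sumr.
rewrite ssum_hyperbola //; apply: eq_ssum => // k k0 _.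
rewrite mulr_suml; apply: eq_big_seq => d; rewrite -dvdn_divisors // => dk.
congr (_ * F _); rewrite -mulrA -invfM -natrM; congr (_ / _%:R).
by rewrite mulnC divnK.
Qed.

Lemma ssum_div_mul x (g : nat -> R) (F : R -> R) : 0 <= x ->
  \ssum_(m <= x) \ssum_(d <= x / m%:R) (g d * F (x / m%:R / d%:R)) =
  \ssum_(k <= x) ((\sum_(d <- divisors k) g d) * F (x / k%:R)).
Proof.
move=> x0; rewrite ssum_hyperbola //; apply: eq_ssum => // k k0 _.
rewrite (sum_divisorsC (fun m d => g d * F (x / m%:R / d%:R))) // mulr_suml.
apply: eq_big_seq => d; rewrite -dvdn_divisors // => dk.
by congr (_ * F _); rewrite -mulrA -invfM -natrM divnK.
Qed.

Lemma moebius_inversion x (H : R -> R) : 1 <= x ->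
  \ssum_(d <= x) (moebius d * \ssum_(m <= x / d%:R) H (x / d%:R / m%:R)) = H x.
Proof.
move=> x1; have x0 : 0 <= x by lra.
rewrite ssum_mul_div // big_nat_recl; last by rewrite truncn_ge_nat.
rewrite sum_moebius_divisors // mul1r divr1 big_nat big1 ?addr0 // => k /andP[k1 _].
by rewrite sum_moebius_divisors // eqSS -[k == 0%N]negbK -lt0n k1 mul0r.
Qed.

Definition psi x : R := \ssum_(n <= x) mangoldt n.
Definition mertens x : R := \ssum_(n <= x) (mangoldt n / n%:R).

Lemma ssum_psi x : 0 <= x -> \ssum_(m <= x) psi (x / m%:R) = \ssum_(k <= x) ln k%:R.
Proof.
move=> x0; have := ssum_div_mul mangoldt (fun=> 1) x0.
under eq_bigr do under eq_bigr do rewrite mulr1.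
move=> ->; apply: eq_ssum => // k k0 _.
by rewrite mulr1 sum_mangoldt_divisors.
Qed.

Lemma ssum_mangoldt_truncn x : 0 <= x ->
  \ssum_(n <= x) (mangoldt n * (Num.truncn (x / n%:R))%:R) = \ssum_(k <= x) ln k%:R :> R.
Proof.
move=> x0; have := ssum_mul_div mangoldt (fun=> 1) x0.
under eq_bigr do rewrite sumr_const_nat subn1 /=.
move=> ->; apply: eq_ssum => // k k0 _.
by rewrite mulr1 sum_mangoldt_divisors.
Qed.

(** The coefficient of [F (x / k)] on the left is [ln (x / k)] plus the sum of [mangoldt] over the
    divisors of [k], that is [ln (x / k) + ln k = ln x]. *)
Lemma ssum_tatuzawa_iseki x (F : R -> R) : 0 <= x ->
  \ssum_(m <= x) (F (x / m%:R) * ln (x / m%:R) +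
      \ssum_(n <= x / m%:R) (mangoldt n * F (x / m%:R / n%:R))) =
  ln x * \ssum_(m <= x) F (x / m%:R).
Proof.
move=> x0; rewrite big_split /= ssum_div_mul // mulr_sumr -big_split /=.
apply: eq_ssum => // k k0 kx; rewrite sum_mangoldt_divisors //.
have k0' : 0 < k%:R :> R by rewrite ltr0n.
rewrite ln_div ?posrE //; first by ring.
exact: lt_le_trans kx.
Qed.

Lemma ln_le_sub (a b : R) : 0 < a -> 0 < b -> ln b - ln a <= (b - a) / a.
Proof.
move=> a0 b0; rewrite -ln_div ?posrE //.
have -> : b / a = 1 + (b - a) / a by field; lra.
apply: le_ln1Dx; rewrite ltr_pdivlMr //; lra.
Qed.

Lemma ln_ge_sub (a b : R) : 0 < a -> 0 < b -> (b - a) / b <= ln b - ln a.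
Proof. by move=> a0 b0; have := ln_le_sub b0 a0; rewrite -(opprB b a) mulNr; lra. Qed.

Lemma lnfact_bounds (N : nat) : (0 < N)%N ->
  N%:R * ln N%:R - N%:R + 1 <= \sum_(1 <= k < N.+1) ln k%:R :> R /\
  \sum_(1 <= k < N.+1) ln k%:R <= N%:R * ln N%:R - N%:R + 1 + ln N%:R :> R.
Proof.
elim: N => // -[_ _|N IH _]; first by rewrite big_nat1 ln1; lra.
rewrite big_nat_recr //=; have {IH}[] := IH isT.
set S := \sum_(_ <= _ < _) _ => S1 S2.
set n : R := N.+1%:R in S1 S2 *; have n0 : 0 < n by rewrite ltr0n.
have -> : N.+2%:R = n + 1 :> R by rewrite -natr1.
have n1 : 0 < n + 1 by lra.
have := ln_le_sub n0 n1; have := ln_ge_sub n0 n1.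
rewrite (_ : n + 1 - n = 1); last by ring.
rewrite ler_pdivrMr // ler_pdivlMr // => h1 h2; split; nra.
Qed.

Lemma lnfact_approx x : 1 <= x ->
  `|\ssum_(k <= x) ln k%:R - (x * ln x - x)| <= 1 + ln x.
Proof.
move=> x1; have x0 : 0 <= x by lra.
have N1 : (0 < Num.truncn x)%N by rewrite truncn_gt0.
have [] := lnfact_bounds N1; have /andP[] := truncn_itv x0.
set S := \sum_(_ <= _ < _) _; rewrite -natr1.
have : 1 <= (Num.truncn x)%:R :> R by rewrite ler1n.
move: (Num.truncn x)%:R => n n1 nx xn S1 S2.
have n0 : 0 < n by lra.
have x0' : 0 < x by lra.
have := ln_le_sub n0 x0'; have := ln_ge_sub n0 x0'.
have ln0 : 0 <= ln n by exact: ln_ge0.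
rewrite ler_pdivrMr // ler_pdivlMr // => h1 h2.
have lnx : ln n <= ln x by rewrite ler_ln.
rewrite ler_norml; apply/andP; split; nra.
Qed.

(** The constant is Euler's: with [H] the harmonic sum, [H n - ln n] decreases and
    [H n - ln n - 1 / n] increases, and [g] is the supremum of the latter. In the proof [a] and [b]
    are these sequences shifted by one. *)
Lemma harmonic_nat : exists g : R, forall N : nat, (0 < N)%N ->
  g <= \sum_(1 <= k < N.+1) k%:R^-1 - ln N%:R <= g + N%:R^-1.
Proof.
pose H N : R := \sum_(1 <= k < N.+1) k%:R^-1.
pose a N : R := H N.+1 - ln N.+1%:R.
pose b N : R := a N - N.+1%:R^-1.
have step N : a N.+1 <= a N /\ b N <= b N.+1.
  rewrite /b /a [H N.+2]/H big_nat_recr //= -/(H N.+1).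
  set n : R := N.+1%:R; have n0 : 0 < n by rewrite ltr0n.
  have -> : N.+2%:R = n + 1 :> R by rewrite -natr1.
  have n1 : 0 < n + 1 by lra.
  have := ln_le_sub n0 n1; have := ln_ge_sub n0 n1.
  rewrite (_ : n + 1 - n = 1) ?div1r; last by ring.
  by move: (_^-1) (n^-1) => u v h1 h2; split; lra.
have ba N : b N <= a N by rewrite /b gerBl invr_ge0.
have amono M N : (M <= N)%N -> a N <= a M.
  elim: N => [|N IH]; first by rewrite leqn0 => /eqP ->.
  rewrite leq_eqVlt => /predU1P[-> //|/IH]; apply: le_trans; exact: (step N).1.
have bmono M N : (M <= N)%N -> b M <= b N.
  elim: N => [|N IH]; first by rewrite leqn0 => /eqP ->.
  rewrite leq_eqVlt => /predU1P[-> //|/IH] /le_trans; apply; exact: (step N).2.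
have bla M N : b M <= a N.
  apply: le_trans (bmono _ _ (leq_maxl M N)) _; apply: le_trans (ba _) _.
  by apply: amono; exact: leq_maxr.
have ubE N : ubound (range b) (a N) by move=> _ [M _ <-]; exact: bla.
exists (sup (range b)) => -[//|N] _; rewrite -/(H N.+1) -/(a N); apply/andP; split.
  by apply: ge_sup => //; exists (b 0%N), 0%N.
rewrite -lerBlDr -/(b N); apply: ub_le_sup; last by exists N.
by exists (a 0%N).
Qed.

Lemma harmonic_approx : exists g : R, forall x, 1 <= x ->
  `|\ssum_(k <= x) k%:R^-1 - ln x - g| <= 2 / x.
Proof.
have [g gP] := harmonic_nat; exists g => x x1; have x0 : 0 <= x by lra.
have N1 : (0 < Num.truncn x)%N by rewrite truncn_gt0.
have := gP _ N1; have /andP[] := truncn_itv x0.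
set S := \sum_(_ <= _ < _) _; rewrite -natr1.
have : 1 <= (Num.truncn x)%:R :> R by rewrite ler1n.
move: (Num.truncn x)%:R => n n1 nx xn /andP[S1 S2].
have n0 : 0 < n by lra.
have x0' : 0 < x by lra.
have lnx : ln n <= ln x by rewrite ler_ln.
have := ln_le_sub n0 x0' => h2.
have h3 : n^-1 <= 2 / x by rewrite ler_pdivlMr // mulrC ler_pdivrMr; lra.
have h4 : (x - n) / n <= n^-1 by rewrite ler_pdivrMr // mulVf; lra.
rewrite ler_norml; apply/andP; split; lra.
Qed.

(** With [z] the fourth root of [x], [1 + ln x = 1 + 4 ln z <= 4 z]. *)
Lemma ln_sqr_le_sqrt x : 1 <= x -> (1 + ln x) ^+ 2 <= 16 * Num.sqrt x.
Proof.
move=> x1; pose z := Num.sqrt (Num.sqrt x).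
have s1 : 1 <= Num.sqrt x by rewrite -[X in X <= _]sqrtr1 ler_sqrt; lra.
have z1 : 1 <= z by rewrite -[X in X <= _]sqrtr1 ler_sqrt; lra.
have z2 : z ^+ 2 = Num.sqrt x by rewrite sqr_sqrtr; lra.
have z4 : z ^+ 4 = x by rewrite (exprM z 2 2) z2 sqr_sqrtr; lra.
rewrite -z2 -[in ln _]z4 lnXn; last by lra.
have lz : ln z <= z - 1.
  by have := @ln_le_sub 1 z; rewrite ln1 divr1 subr0; apply; lra.
have lz0 := ln_ge0 z1.
rewrite -[_ *+ 4]mulr_natr; nra.
Qed.

Lemma sum_inv_sqrt (N : nat) :
  \sum_(1 <= k < N.+1) (Num.sqrt k%:R)^-1 <= 2 * Num.sqrt N%:R :> R.
Proof.
elim: N => [|N IH]; first by rewrite big_geq // sqrtr0 mulr0.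
rewrite big_nat_recr //=; set S := \sum_(_ <= _ < _) _ in IH *.
set s : R := Num.sqrt N%:R in IH *; set t : R := Num.sqrt N.+1%:R.
have s0 : 0 <= s by exact: sqrtr_ge0.
have t0 : 0 < t by rewrite sqrtr_gt0 ltr0n.
have s2 : s ^+ 2 = N%:R by rewrite sqr_sqrtr.
have t2 : t ^+ 2 = s ^+ 2 + 1 by rewrite sqr_sqrtr // s2 natr1.
suff : t^-1 <= 2 * t - 2 * s by lra.
rewrite -[X in X <= _]mul1r ler_pdivrMr //.
have : 0 <= (t - s) ^+ 2 by exact: sqr_ge0.
lra.
Qed.

Lemma ssum_sqrt_div x : 1 <= x -> \ssum_(d <= x) Num.sqrt (x / d%:R) <= 2 * x.
Proof.
move=> x1; have x0 : 0 <= x by lra.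
under eq_bigr do rewrite sqrtrM // sqrtrV //.
rewrite -mulr_sumr; apply: (@le_trans _ _ (Num.sqrt x * (2 * Num.sqrt x))).
  rewrite ler_wpM2l ?sqrtr_ge0 //; apply: le_trans (sum_inv_sqrt _) _.
  by rewrite ler_wpM2l // ler_sqrt // truncn_le.
by have := sqr_sqrtr x0; nra.
Qed.

(** After inversion the term of index [d] is at most [16 K] times the square root of [x / d], and
    these roots sum to at most [2 x]; hence 32. Squared logarithms in the hypothesis thus leave no
    logarithm in the conclusion. *)
Lemma moebius_bound (H : R -> R) K :
  (forall y, 1 <= y -> `|\ssum_(m <= y) H (y / m%:R)| <= K * (1 + ln y) ^+ 2) ->
  forall x, 1 <= x -> `|H x| <= 32 * K * x.
Proof.
move=> HK x x1; have x0 : 0 <= x by lra.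
have K0 : 0 <= K.
  have := HK 1 (lexx _); rewrite ln1 addr0 expr1n mulr1; exact: le_trans.
rewrite -(moebius_inversion H x1).
apply: (@le_trans _ _ (\ssum_(d <= x) (K * 16 * Num.sqrt (x / d%:R)))).
  apply: ler_norm_ssum => // d d0 dx; have d0' : 0 < d%:R :> R by rewrite ltr0n.
  have xd : 1 <= x / d%:R by rewrite ler_pdivlMr // mul1r.
  rewrite normrM -[X in _ <= X]mul1r ler_pM ?norm_moebius_le1 //.
  apply: le_trans (HK _ xd) _; rewrite -mulrA ler_wpM2l //.
  exact: ln_sqr_le_sqrt.
rewrite -mulr_sumr.
apply: le_trans (ler_wpM2l _ (ssum_sqrt_div x1)) _; last by lra.
by rewrite mulr_ge0.
Qed.

End SumsUpToReal.

(** * Selberg's formula *)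

Section Selberg.
Context {R : realType}.
Implicit Types x y : R.

Lemma psi_ge0 x : 0 <= psi x.
Proof. by apply: sumr_ge0 => n _; exact: mangoldt_ge0. Qed.

Lemma ssum_const x (c : R) : \ssum_(m <= x) c = c * (Num.truncn x)%:R.
Proof. by rewrite sumr_const_nat subn1 /= mulr_natr. Qed.

(* With c = gamma + 1 the terms x ln x and x cancel in the sum. *)
Lemma ssum_remainder : exists c K : R, forall x, 1 <= x ->
  `|\ssum_(m <= x) (psi (x / m%:R) - x / m%:R + c)| <= K * (1 + ln x).
Proof.
(* In the second witness, 2 comes from the harmonic sum, [|g + 1|] from the fractional part of [x],
   and the rest from the factorial. *)
have [g gP] := @harmonic_approx R; exists (g + 1), (3 + `|g + 1|) => x x1.
have x0 : 0 <= x by lra.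
rewrite big_split /= sumrB -mulr_sumr ssum_psi // ssum_const.
have := lnfact_approx x1; set T := \ssum_(_ <= _) _ => hT.
have := gP x x1; set H := \ssum_(_ <= _) _ => hH.
have /andP[] := truncn_itv x0; rewrite -natr1.
move: (Num.truncn x)%:R => n nx xn.
have lx : 0 <= ln x by exact: ln_ge0.
have hH' : `|x * H - x * ln x - x * g| <= 2.
  rewrite -!mulrBr normrM (ger0_norm x0) -[X in _ <= X](@divfK _ x); last by lra.
  by rewrite mulrC ler_wpM2r.
have hn : `|(g + 1) * (x - n)| <= `|g + 1|.
  by rewrite normrM ler_piMr // ger0_norm; lra.
have h3 := normr_ge0 (g + 1).
have -> : T - x * H + (g + 1) * n = (T - (x * ln x - x))
   - (x * H - x * ln x - x * g) - (g + 1) * (x - n) by ring.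
apply: le_trans (ler_normB _ _) _; apply: le_trans (lerD (ler_normB _ _) (lexx _)) _.
nra.
Qed.

Lemma ln_le_id x : 0 < x -> ln x <= x.
Proof. by move=> /ln_sublinear /ltW. Qed.

(* The second bound is the Tatuzawa-Iseki inequality: the logarithm that Moebius
   inversion would lose is absorbed, as the inverted sum is only O(ln^2). *)
Lemma remainder_linear : exists c K : R,
  (forall x, 1 <= x -> `|psi x - x + c| <= K * x) /\
  (forall x, 1 <= x -> `|(psi x - x + c) * ln x +
      \ssum_(n <= x) (mangoldt n * (psi (x / n%:R) - x / n%:R + c))| <= K * x).
Proof.
have [c [K cK]] := ssum_remainder; exists c, (32 * K).
have K0 : 0 <= K.
  by have := cK 1 (lexx _); rewrite ln1 addr0 mulr1; apply: le_trans.
pose F x := psi x - x + c; split => x x1.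
  apply: (@moebius_bound _ F) x1 => y y1; apply: le_trans (cK _ y1) _.
  by rewrite ler_wpM2l // expr2 ler_peMr; have := ln_ge0 y1; lra.
apply: (@moebius_bound _ (fun x => F x * ln x + \ssum_(n <= x) (mangoldt n * F (x / n%:R)))) x1 => y y1.
have ly := ln_ge0 y1.
rewrite ssum_tatuzawa_iseki; last by lra.
rewrite normrM (ger0_norm ly).
apply: le_trans (ler_wpM2l ly (cK _ y1)) _; nra.
Qed.

Lemma chebyshev : exists2 K : R, 0 <= K & forall x, 0 <= x -> psi x <= K * x.
Proof.
have [c [K [cK _]]] := remainder_linear; exists (K + 1 + `|c|).
  have := cK 1 (lexx _); have := normr_ge0 c; have := normr_ge0 (psi 1 - 1 + c).
  lra.
move=> x x0; case: (leP 1 x) => x1; last first.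
  rewrite /psi (_ : Num.truncn x = 0%N) ?big_geq //.
    apply: mulr_ge0 => //; have := cK 1 (lexx _); have := normr_ge0 c.
    by have := normr_ge0 (psi 1 - 1 + c); lra.
  by apply/eqP; rewrite -leqn0 truncn_le_nat.
have := cK _ x1; rewrite ler_norml => /andP[_ h].
have hc : - c <= `|c| by rewrite -normrN ler_norm.
have := normr_ge0 c; nra.
Qed.

(** Compares [x * mertens x] with the logarithm of the factorial, in which [x / n] is rounded down;
    the rounding costs at most [psi x], which is O(x) by [chebyshev]. *)
Lemma mertens_approx : exists K : R, forall x, 1 <= x -> `|mertens x - ln x| <= K.
Proof.
have [K K0 psiK] := chebyshev; exists (3 + K) => x x1.
have x0 : 0 <= x by lra.
have x0' : 0 < x by lra.
have := lnfact_approx x1; rewrite -ssum_mangoldt_truncn //.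
set T := \ssum_(_ <= _) _ => hT.
have T1 : T <= x * mertens x.
  rewrite /mertens mulr_sumr; apply: ler_ssum => // n n0 _.
  rewrite mulrCA; apply: ler_wpM2l; first exact: mangoldt_ge0.
  by rewrite truncn_le divr_ge0.
have T2 : x * mertens x - psi x <= T.
  rewrite /mertens /psi mulr_sumr -sumrB; apply: ler_ssum => // n n0 _.
  rewrite mulrCA -[X in _ - X]mulr1 -mulrBr; apply: ler_wpM2l; first exact: mangoldt_ge0.
  by have := truncnS_gt (x / n%:R); rewrite -natr1; lra.
have := psiK x x0; have := ln_le_id x0' => lx hp.
rewrite -(ler_pM2l x0') -[X in X * `|_|](ger0_norm x0) -normrM mulrBr.
move: hT; rewrite !ler_norml => /andP[hT1 hT2].
apply/andP; split; lra.
Qed.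

(** Expands the second bound of [remainder_linear]. One [x ln x] comes from the main term of
    [psi x - x + c], the other from [x * mertens x]; both terms in [c] are O(x). *)
Lemma selberg : exists2 K : R, 0 <= K & forall x, 1 <= x ->
  `|psi x * ln x + \ssum_(n <= x) (mangoldt n * psi (x / n%:R)) - 2 * x * ln x| <= K * x.
Proof.
have [c [K [_ cK]]] := remainder_linear.
have [K1 K10 psiK] := chebyshev; have [K2 mertensK] := mertens_approx.
have K20 : 0 <= K2 by apply: le_trans (mertensK 1 (lexx _)).
have K0 : 0 <= K by have := cK 1 (lexx _); rewrite mulr1; apply: le_trans.
exists (K + `|c| + K2 + `|c| * K1).
  by rewrite !addr_ge0 // mulr_ge0.
move=> x x1; have x0 : 0 <= x by lra.
have x0' : 0 < x by lra.
have := cK x x1.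
have -> : \ssum_(n <= x) (mangoldt n * (psi (x / n%:R) - x / n%:R + c)) =
   \ssum_(n <= x) (mangoldt n * psi (x / n%:R)) - x * mertens x + c * psi x.
  rewrite /mertens /psi !mulr_sumr -sumrB -big_split /=; apply: eq_bigr => n _.
  by ring.
set S := \ssum_(_ <= _) _ => h.
have hm : `|x * mertens x - x * ln x| <= x * K2.
  by rewrite -mulrBr normrM (ger0_norm x0) ler_wpM2l // mertensK.
have hp : `|c * psi x| <= `|c| * K1 * x.
  by rewrite normrM (ger0_norm (psi_ge0 x)) -mulrA ler_wpM2l // psiK.
have hl : `|c * ln x| <= `|c| * x.
  rewrite normrM ler_wpM2l // ger0_norm ?ln_le_id //; exact: ln_ge0.
have -> : psi x * ln x + S - 2 * x * ln x =
  ((psi x - x + c) * ln x + (S - x * mertens x + c * psi x)) +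
  (x * mertens x - x * ln x) - c * psi x - c * ln x by ring.
apply: le_trans (ler_normB _ _) _.
apply: le_trans (lerD (ler_normB _ _) (lexx _)) _.
apply: le_trans (lerD (lerD (ler_normD _ _) (lexx _)) (lexx _)) _.
lra.
Qed.

End Selberg.

(** * Erdos' argument *)

Section Erdos.
Context {R : realType}.
Implicit Types x y : R.

Lemma ler_ssum_itv x y (F G : nat -> R) : 0 <= x -> x <= y ->
  (forall n, (0 < n)%N -> x < n%:R -> n%:R <= y -> F n <= G n) ->
  \ssum_(n <= y) F n - \ssum_(n <= x) F n <= \ssum_(n <= y) G n - \ssum_(n <= x) G n.
Proof.
move=> x0 xy FG; have txy : (Num.truncn x <= Num.truncn y)%N by exact: le_truncn.
rewrite !(@big_cat_nat _ _ _ (Num.truncn x).+1 1 (Num.truncn y).+1) //=.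
rewrite !(addrAC _ _ (- _)) !subrr !add0r.
apply: ler_sum_nat => n /andP[xn ny]; apply: FG.
- exact: leq_trans xn.
- by move: xn; rewrite truncn_lt_nat.
- by move: ny; rewrite ltnS truncn_ge_nat // (le_trans x0).
Qed.

Lemma le_ssum x y (F : nat -> R) : 0 <= x -> x <= y ->
  (forall n, (0 < n)%N -> x < n%:R -> n%:R <= y -> 0 <= F n) ->
  \ssum_(n <= x) F n <= \ssum_(n <= y) F n.
Proof.
move=> x0 xy F0; have := ler_ssum_itv x0 xy F0.
have z w : \ssum_(n <= w) (0 : R) = 0 by rewrite big1.
by rewrite !z subrr subr_ge0.
Qed.

Lemma le_psi x y : 0 <= x -> x <= y -> psi x <= psi y.
Proof. by move=> x0 xy; apply: le_ssum => // n *; exact: mangoldt_ge0. Qed.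

Lemma le_mertens x y : 0 <= x -> x <= y -> mertens x <= mertens y.
Proof.
by move=> x0 xy; apply: le_ssum => // n *; rewrite divr_ge0 ?mangoldt_ge0.
Qed.

Lemma mertens_psi_le x y : 0 < x -> x <= y ->
  (psi y - psi x) / y <= mertens y - mertens x <= (psi y - psi x) / x.
Proof.
move=> x0 xy; have y0 : 0 < y by lra.
rewrite mulrBl /psi !mulr_suml mulrBl !mulr_suml; apply/andP; split.
  apply: ler_ssum_itv => // [|n n0 xn ny]; first exact: ltW.
  by rewrite ler_wpM2l ?mangoldt_ge0 // lef_pV2 ?posrE ?ltr0n.
apply: ler_ssum_itv => // [|n n0 xn ny]; first exact: ltW.
by rewrite ler_wpM2l ?mangoldt_ge0 // lef_pV2 ?posrE ?ltr0n // ltW.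
Qed.

Lemma psi_local (k : R) : 0 < k -> exists2 Y : R, 1 <= Y &
  forall x y, 1 <= x -> x <= y -> Y <= y -> psi y - psi x <= 2 * (y - x) + k * y.
Proof.
move=> k0; have [K K0 selK] := @selberg R.
pose L := (2 + 2 * K) / k; have L0 : 0 < L by rewrite divr_gt0 //; lra.
exists (expR L); first by rewrite -expR0 ler_expR ltW.
move=> x y x1 xy Yy; have y1 : 1 <= y by lra.
have Lly : L <= ln y by rewrite -ler_expR lnK // posrE; lra.
have ly0 : 0 < ln y by lra.
have := selK _ x1; have := selK _ y1.
set Sx := \ssum_(_ <= x) _; set Sy := \ssum_(_ <= y) _.
have SS : Sx <= Sy.
  apply: (@le_trans _ _ (\ssum_(n <= x) (mangoldt n * psi (y / n%:R)))).
    apply: ler_ssum => [|n n0 _]; first lra.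
    rewrite ler_wpM2l ?mangoldt_ge0 // le_psi ?divr_ge0 //; first lra.
    by rewrite ler_wpM2r // invr_ge0.
  apply: le_ssum => // [|n *]; first lra.
  by rewrite mulr_ge0 ?mangoldt_ge0 ?psi_ge0.
rewrite !ler_norml => /andP[_ h2] /andP[h1 _].
have lxy : x * (ln y - ln x) <= y - x.
  have := @ln_le_sub _ x y; rewrite ler_pdivlMr; last lra.
  by rewrite mulrC; apply; lra.
have lx0 := ln_ge0 x1.
have px := psi_ge0 x.
have lle : ln x <= ln y by rewrite ler_ln // posrE; lra.
have kL : (2 + 2 * K) * y <= k * y * ln y.
  have -> : (2 + 2 * K) * y = k * y * L by rewrite /L; field; lra.
  by rewrite ler_wpM2l // mulr_ge0; lra.
rewrite -(ler_pM2r ly0).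
have : psi x * ln x <= psi x * ln y by rewrite ler_wpM2l.
have : K * x <= K * y by rewrite ler_wpM2l.
lra.
Qed.

(** The lower limit of [(psi (e^d x) - psi x) / x] at infinity is 0. Its negation thus gives a fixed
    positive proportion of mass in every such interval far out, which is how near-maximality of [d]
    is exploited. *)
Definition gap (d : R) := forall e X : R, 0 < e ->
  exists2 x, X <= x & psi (expR d * x) - psi x <= e * x.

Lemma gap_le (d d' : R) : d' <= d -> gap d -> gap d'.
Proof.
move=> dd gd e X e0; have [x Xx px] := gd e (Num.max X 0) e0.
move: Xx; rewrite ge_max => /andP[Xx x0].
exists x => //; apply: le_trans px; rewrite lerD2r le_psi //.
  by rewrite mulr_ge0 ?expR_ge0.
by rewrite ler_wpM2r // ler_expR.
Qed.

(** By Mertens an interval of log-length [2 K + 1] carries mass at least 1 in the sum of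
    [mangoldt n / n], whereas a gap with [e = 1 / 2] would leave at most 1/2. *)
Lemma gap_bounded : exists D : R, ~ gap D.
Proof.
have [K mK] := @mertens_approx R; pose D := 2 * K + 1; exists D => gD.
have K0 : 0 <= K by apply: le_trans (mK 1 (lexx _)).
have [x x1 h] := gD (1 / 2) 1 ltac:(lra).
have x0 : 0 < x by lra.
have eD : 1 <= expR D by rewrite -expR0 ler_expR /D; lra.
have xD : x <= expR D * x by rewrite ler_peMl // ltW.
have xD1 : 1 <= expR D * x by lra.
have /andP[_] := mertens_psi_le x0 xD.
have := mK _ x1; have := mK _ xD1; rewrite lnM ?posrE ?expR_gt0 // expRK.
rewrite !ler_norml => /andP[h1 _] /andP[_ h2] h3.
have : (psi (expR D * x) - psi x) / x <= 1 / 2 by rewrite ler_pdivrMr.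
rewrite /D in h1 h3 *; lra.
Qed.

(** Replaces a maximal gap length: multiply by 6/5 until the gap property fails, which must happen
    by [gap_bounded]. *)
Lemma gap_threshold (d : R) : 0 < d -> gap d ->
  exists2 d', 0 < d' & gap d' /\ ~ gap (6 / 5 * d').
Proof.
move=> d0 gd; apply: contrapT => H.
have gk k : gap ((6 / 5) ^+ k * d).
  elim: k => [|k IH]; first by rewrite expr0 mul1r.
  apply: contrapT => ng; apply: H; exists ((6 / 5) ^+ k * d).
    by rewrite mulr_gt0 // exprn_gt0 //; lra.
  by split => //; rewrite mulrA -exprS.
have [D] := gap_bounded; apply.
have ber k : 1 + k%:R / 5 <= (6 / 5) ^+ k :> R.
  elim: k => [|k IH]; first by rewrite expr0; lra.
  rewrite exprS -natr1; have : 0 <= k%:R :> R by []. move: IH; nra.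
have [k kD] : exists k, D <= (6 / 5) ^+ k * d.
  exists (Num.truncn (5 * D / d)).+1.
  rewrite -ler_pdivrMr //; apply: le_trans (ber _).
  by have := truncnS_gt (5 * D / d); lra.
exact: gap_le kD (gk k).
Qed.

(** Measures how far [psi] falls short of density 2 on [(y, lam * y]]. The slack [k] makes it
    nonnegative for large [y]. *)
Definition deficit (lam k : R) y : R := 2 * (lam - 1) + k - (psi (lam * y) - psi y) / y.

Definition deficit_sum (lam k : R) x (z : R) : R :=
  \ssum_(n <= z) (mangoldt n / n%:R * deficit lam k (x / n%:R)).

(** Let [x] start a gap and subtract Selberg's formula at [x] from that at [lam * x]. The terms in
    [psi] nearly cancel, so the increments [psi (lam * x / n) - psi (x / n)], weighted by
    [mangoldt n], must supply almost all of [2 (lam - 1) x ln x], which leaves little room for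
    deficits. *)
Lemma deficit_sum_small (d k Y X : R) : 0 < d -> gap d -> 0 < k -> 1 <= Y ->
  exists2 x, X <= x & deficit_sum (expR d) k x (x / Y) <= 2 * k * ln x.
Proof.
move=> d0 gd k0 Y1; set lam := expR d.
have lam1 : 1 < lam by rewrite expR_gt1.
have [K K0 selK] := @selberg R; have [K1 K10 psiK] := @chebyshev R.
have [K2 mK] := @mertens_approx R.
have K20 : 0 <= K2 by apply: le_trans (mK 1 (lexx _)).
(* [C] collects all errors of order [x], and [x] is taken so large that [C <= k / 2 * ln x]. The gap
   costs another [k / 2 * ln x] and the slack in [deficit] costs [k * ln x]. *)
pose C := K * lam + K + K1 ^+ 2 * lam ^+ 2 + d * K1 * lam + K1 * lam * (ln Y + 2 * K2)
   + (2 * (lam - 1) + k) * K2.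
have [x Xx hx] := gd (k / 2) (Num.max X (Num.max Y (expR (2 * C / k)))) ltac:(lra).
move: Xx; rewrite !ge_max => /and3P[Xx Yx Cx]; exists x => //.
have x1 : 1 <= x by lra.
have x0 : 0 < x by lra.
have x0' := ltW x0.
have Cl : 2 * C / k <= ln x by rewrite -ler_expR lnK.
have {Cl} Cl : C <= k / 2 * ln x by move: Cl; rewrite ler_pdivrMr //; lra.
have lx1 : 1 <= lam * x by nra.
have xlx : x <= lam * x by nra.
have Y0 : 0 < Y by lra.
have xY0 : 0 <= x / Y by rewrite divr_ge0 // ltW.
have xYx : x / Y <= x by rewrite ler_pdivrMr //; nra.
have xY1 : 1 <= x / Y by rewrite ler_pdivlMr // mul1r.
have lx := ln_ge0 x1.
pose D (z : R) : R := \ssum_(n <= z) (mangoldt n * (psi (lam * x / n%:R) - psi (x / n%:R))).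
(* The range [n > x / Y], where [x / n < Y] and the sign of the deficit is uncontrolled, is cut off
   at cost O(x). *)
have DY : D x - D (x / Y) <= K1 * lam * x * (ln Y + 2 * K2).
  apply: (@le_trans _ _ (K1 * lam * x * (mertens x - mertens (x / Y)))); last first.
    rewrite ler_wpM2l //; first by rewrite !mulr_ge0 //; lra.
    have := mK _ x1; have := mK _ xY1; rewrite ln_div ?posrE //.
    by rewrite !ler_norml => /andP[h1 _] /andP[_ h2]; lra.
  rewrite mulrBr /mertens !mulr_sumr; apply: ler_ssum_itv => // n n0 _ nx.
  rewrite mulrCA ler_wpM2l ?mangoldt_ge0 //.
  apply: (@le_trans _ _ (psi (lam * x / n%:R))).
    by have := psi_ge0 (x / n%:R); lra.
  apply: le_trans (psiK _ _) _; first by rewrite divr_ge0 // mulr_ge0 //; lra.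
  by rewrite !mulrA.
have Dlow : 2 * (lam - 1) * x * ln x - k / 2 * x * ln x -
    (K * lam + K + K1 ^+ 2 * lam ^+ 2 + d * K1 * lam) * x <= D x.
  have := selK _ x1; have := selK _ lx1.
  rewrite lnM ?posrE ?expR_gt0 // expRK.
  set Sl := \ssum_(_ <= lam * x) _; set Sx := \ssum_(_ <= x) _.
  rewrite !ler_norml => /andP[h1 _] /andP[_ h2].
  have DE : D x = \ssum_(n <= x) (mangoldt n * psi (lam * x / n%:R)) - Sx.
    by rewrite /D /Sx -sumrB; apply: eq_bigr => n _; rewrite mulrBr.
  have plx : psi (lam * x) <= K1 * (lam * x) by apply: psiK; lra.
  have tail : Sl - \ssum_(n <= x) (mangoldt n * psi (lam * x / n%:R)) <=
      K1 ^+ 2 * lam ^+ 2 * x.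
    apply: (@le_trans _ _ ((K1 * lam) * (psi (lam * x) - psi x))); last first.
      rewrite (_ : K1 ^+ 2 * lam ^+ 2 * x = (K1 * lam) * (K1 * (lam * x))); last by ring.
      rewrite ler_wpM2l //; first by rewrite mulr_ge0 //; lra.
      by have := psi_ge0 x; lra.
    rewrite mulrBr /psi !mulr_sumr; apply: ler_ssum_itv => // n n0 xn _.
    rewrite mulrC ler_wpM2r ?mangoldt_ge0 //; apply: le_trans (psiK _ _) _.
      by rewrite divr_ge0 //; lra.
    rewrite ler_wpM2l // ler_pdivrMr ?ltr0n //.
    by rewrite ler_wpM2l; lra.
  have : psi (lam * x) * d <= K1 * (lam * x) * d by rewrite ler_wpM2r // ltW.
  have : (psi (lam * x) - psi x) * ln x <= k / 2 * x * ln x by rewrite ler_wpM2r.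
  have : 0 <= lam * x * d by rewrite !mulr_ge0 //; lra.
  lra.
have TE : x * deficit_sum lam k x (x / Y) =
    x * ((2 * (lam - 1) + k) * mertens (x / Y)) - D (x / Y).
  rewrite /deficit_sum /mertens /D !mulr_sumr -sumrB; apply: eq_ssum => // n n0 nx.
  have n0' : n%:R != 0 :> R by rewrite pnatr_eq0 -lt0n.
  by rewrite /deficit !mulrA; field; rewrite n0' gt_eqF.
rewrite -(ler_pM2l x0) TE.
have mY : mertens (x / Y) <= ln x + K2.
  apply: le_trans (le_mertens xY0 xYx) _.
  by have := mK _ x1; rewrite ler_norml => /andP[_]; lra.
have : x * ((2 * (lam - 1) + k) * mertens (x / Y)) <= x * ((2 * (lam - 1) + k) * (ln x + K2)).
  by rewrite ler_wpM2l // ler_wpM2l //; lra.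
have : C * x <= k / 2 * ln x * x by rewrite ler_wpM2r.
rewrite /C; nra.
Qed.

End Erdos.

(** * Windows with small total deficit *)

Section Windows.
Context {R : realType}.
Implicit Types x y : R.

Lemma deficit_ge0 (lam k : R) : 1 < lam -> 0 < k ->
  exists2 Y : R, 1 <= Y & forall y, Y <= y -> 0 <= deficit lam k y.
Proof.
(* [psi_local] measures its error at the right end [lam * y], hence the division by [lam]. *)
move=> l1 k0; have [|Y Y1 YP] := @psi_local R (k / lam); first by rewrite divr_gt0 //; lra.
exists Y => // y Yy; have y1 : 1 <= y by lra.
have yl : y <= lam * y by nra.
rewrite /deficit subr_ge0 ler_pdivrMr; last lra.
apply: le_trans (YP _ _ y1 yl (le_trans Yy yl)) _.
by rewrite mulrA divfK; lra.
Qed.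

Lemma le_deficit_sum (lam k Y x a b : R) : 0 < Y ->
  (forall y, Y <= y -> 0 <= deficit lam k y) ->
  0 <= a -> a <= b -> b <= x / Y -> deficit_sum lam k x a <= deficit_sum lam k x b.
Proof.
move=> Y0 dP a0 ab bx; apply: le_ssum => // n n0 _ nb.
rewrite mulr_ge0 ?divr_ge0 ?mangoldt_ge0 // dP // ler_pdivlMr ?ltr0n //.
by rewrite mulrC -ler_pdivlMr //; lra.
Qed.

(* The B-differences have step 2 because the windows they come from overlap. *)
Lemma pigeonhole_telescope (A B : nat -> R) (s : R) m :
  (forall j, (1 <= j <= m)%N -> s < (A j.+1 - A j) + (B j.-1 - B j.+1)) ->
  m%:R * s <= A m.+1 - A 1%N + B 0%N + B 1%N - B m - B m.+1.
Proof.
elim: m => [|m IH] H; first by rewrite mul0r; lra.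
have := H m.+1; rewrite leqnn /= => /(_ isT) h.
have : m%:R * s <= A m.+1 - A 1%N + B 0%N + B 1%N - B m - B m.+1.
  by apply: IH => j /andP[j1 jm]; apply: H; rewrite j1 ltnW.
rewrite -natr1; lra.
Qed.

(** Windows of log-length [W] tile the range from [Y] to [x / Y]. Deficits in the windows and in
    their reflections under [n -> x / n], widened by [W], add up to at most three times the total
    [2 k ln x]; with at least [ln x / (2 W)] windows, one of them meets both bounds. *)
Lemma good_window (d k W s Y : R) : 0 < d -> gap d -> 0 < k -> 0 < W -> 1 <= Y ->
  12 * W * k < s -> (forall y, Y <= y -> 0 <= deficit (expR d) k y) ->
  exists x N, [/\ Y * expR W <= N, N * expR W <= x / Y,
    deficit_sum (expR d) k x (N * expR W) - deficit_sum (expR d) k x N <= s &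
    deficit_sum (expR d) k x (x * expR W / N) -
    deficit_sum (expR d) k x (x / (N * expR W)) <= s].
Proof.
move=> d0 gd k0 W0 Y1 Wks dP; set lam := expR d in dP *.
have Y0 : 0 < Y by lra.
have [x] := deficit_sum_small (expR (4 * ln Y + 4 * W)) d0 gd k0 Y1.
rewrite -/lam; set T := deficit_sum lam k x => Xx Tx.
have x0 : 0 < x by apply: lt_le_trans Xx; exact: expR_gt0.
have lx : 4 * ln Y + 4 * W <= ln x by rewrite -ler_expR lnK.
have lY := ln_ge0 Y1.
have xY0 : 0 < x / Y by rewrite divr_gt0.
have Tmono a b : 0 <= a -> a <= b -> b <= x / Y -> T a <= T b.
  exact: (le_deficit_sum Y0 dP).
have T0 a : 0 <= a -> a <= x / Y -> 0 <= T a.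
  move=> a0 ax; have := Tmono 0 a (lexx _) a0 ax.
  by rewrite {1}/T /deficit_sum truncn0 big_geq.
(* Chosen so that [m.+1] steps from [Y] stay below [x / Y] while [m * W] is still at least
   [ln x / 2]. *)
pose q := (ln x - 2 * ln Y) / W - 2.
have q0 : 0 <= q by rewrite /q subr_ge0 ler_pdivlMr //; lra.
pose m := (Num.truncn q).+1.
have mle : (m.+1)%:R * W <= ln x - 2 * ln Y.
  rewrite -ler_pdivlMr // /m -!natr1.
  by have := truncn_le q; rewrite q0 /q; lra.
have mge : ln x / 2 <= m%:R * W.
  have h : q < m%:R by exact: truncnS_gt.
  have : q * W <= m%:R * W by rewrite ler_wpM2r // ltW.
  rewrite /q mulrBl divfK; last lra.
  lra.
pose N j : R := Y * expR (j%:R * W).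
have N0 j : 0 < N j by rewrite mulr_gt0 ?expR_gt0.
have NS j : N j.+1 = N j * expR W by rewrite /N -natr1 mulrDl mul1r expRD mulrA.
have N00 : N 0%N = Y by rewrite /N mul0r expR0 mulr1.
have Nmono i j : (i <= j)%N -> N i <= N j.
  by move=> ij; rewrite ler_wpM2l ?ler_expR ?ler_wpM2r ?ler_nat //; lra.
have NY j : Y <= N j by rewrite -{1}N00 Nmono.
have Nx j : (j <= m.+1)%N -> N j <= x / Y.
  move=> jm; apply: le_trans (Nmono _ _ jm) _.
  rewrite -[x]lnK ?posrE // -[Y in _ / Y]lnK ?posrE // /N -[Y in Y * _]lnK ?posrE //.
  by rewrite -expRD -expRN -expRD ler_expR; lra.
have xN j : x / N j <= x / Y by rewrite ler_wpM2l ?(ltW x0) // lef_pV2 ?posrE.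
have [j jm [j1 j2]] : exists2 j, (1 <= j <= m)%N &
    T (N j.+1) - T (N j) <= s /\ T (x / N j.-1) - T (x / N j.+1) <= s.
  apply: contrapT => H.
  have h j : (1 <= j <= m)%N ->
      s < (T (N j.+1) - T (N j)) + (T (x / N j.-1) - T (x / N j.+1)).
    move=> /andP[j1 jm]; rewrite ltNge; apply/negP => le; apply: H; exists j.
      by rewrite j1.
    have a1 : T (N j) <= T (N j.+1).
      by apply: Tmono; rewrite ?(ltW (N0 _)) ?Nmono ?Nx.
    have a2 : T (x / N j.+1) <= T (x / N j.-1).
      apply: Tmono => //; first by rewrite divr_ge0 // ltW.
      rewrite ler_wpM2l ?(ltW x0) // lef_pV2 ?posrE // Nmono //.
      by case: (j) => //= i; rewrite -addn2 leq_addr.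
    by split; lra.
  have := @pigeonhole_telescope (T \o N) (fun j => T (x / N j)) s m h => /=.
  have xNpos i : 0 <= x / N i by rewrite divr_ge0 // ltW.
  have := T0 _ (xNpos m) (xN m); have := T0 _ (xNpos m.+1) (xN m.+1).
  have := T0 _ (ltW (N0 1%N)) (Nx 1%N isT).
  have u1 := Tmono _ _ (ltW (N0 m.+1)) (Nx m.+1 (leqnn _)) (lexx _).
  have u2 := Tmono _ _ (xNpos 0%N) (xN 0%N) (lexx _).
  have u3 := Tmono _ _ (xNpos 1%N) (xN 1%N) (lexx _).
  move=> v1 v2 v3 v4.
  have ms : m%:R * s <= 6 * k * ln x by lra.
  have : m%:R * (12 * W * k) < m%:R * s by rewrite ltr_pM2l // ltr0n.
  have : ln x / 2 * (12 * k) <= m%:R * W * (12 * k) by rewrite ler_wpM2r //; lra.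
  lra.
case/andP: jm => j0 jm.
exists x, (N j); rewrite -NS; split => //; last 1 first.
- suff -> : x * expR W / N j = x / N j.-1 by [].
  have -> : N j = N j.-1 * expR W by rewrite -NS prednK.
  by field; rewrite !gt_eqF // expR_gt0.
- by rewrite -N00 -NS Nmono.
- by rewrite Nx.
Qed.

(** Averaging: if all deficits in [(a, b]] exceeded [r], their weighted sum would be at least
    [r / b * (psi b - psi a)], which exceeds [s]. *)
Lemma good_index (lam k x a b s r : R) : 0 < a -> a <= b -> 0 < r ->
  deficit_sum lam k x b - deficit_sum lam k x a <= s ->
  s / r * b < psi b - psi a ->
  exists n : nat, [/\ (0 < n)%N, a < n%:R, n%:R <= b & deficit lam k (x / n%:R) <= r].
Proof.
move=> a0 ab r0 Ts h; apply: contrapT => H; have b0 : 0 < b by lra.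
move: h; apply/negP; rewrite -leNgt mulrAC ler_pdivlMr // -ler_pdivrMr //.
apply: le_trans Ts; rewrite -mulrA mulrBl /psi !mulr_suml.
apply: ler_ssum_itv => [||n n0 an nb] //; first exact: ltW.
rewrite -mulrA [r / b]mulrC ler_wpM2l ?mangoldt_ge0 //.
apply: ler_pM; rewrite ?invr_ge0 ?(ltW b0) ?(ltW r0) //.
  by rewrite lef_pV2 ?posrE ?ltr0n.
by apply/ltW; rewrite ltNge; apply/negP => le; apply: H; exists n.
Qed.

(** Density 2 is the maximum by [psi_local], so an interval that nearly attains it nearly attains it
    on every subinterval: the two outer pieces cannot compensate a loss. *)
Lemma psi_full (lam k r Y y a b : R) : 1 < lam -> 0 < k -> 1 <= Y ->
  (forall x y, 1 <= x -> x <= y -> Y <= y -> psi y - psi x <= 2 * (y - x) + k * y) ->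
  Y <= y -> deficit lam k y <= r -> y <= a -> a <= b -> b <= lam * y ->
  (2 * (b - a)) - (r + 2 * k * lam) * y <= psi b - psi a.
Proof.
move=> l1 k0 Y1 loc Yy def ya ab bl.
have y0 : 0 < y by lra.
have h1 := loc y a ltac:(lra) ya ltac:(lra).
have h2 := loc b (lam * y) ltac:(lra) bl ltac:(lra).
have h3 : (2 * (lam - 1) + k - r) * y <= psi (lam * y) - psi y.
  by rewrite -ler_pdivlMr //; move: def; rewrite /deficit; lra.
have h4 : k * a <= k * (lam * y) by rewrite ler_wpM2l //; lra.
have h5 : 0 <= k * y by rewrite mulr_ge0 // ltW.
lra.
Qed.

End Windows.

(** * Too much mass for Mertens' theorem: no gaps, hence prime powers in short intervals *)

Section Contradiction.
Context {R : realType}.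
Implicit Types x y : R.

(* The hypothesis on 6/5 d gives an n in the middle of the block such that
   (x/n, e^d x/n] has full density; hence it contains, near every prescribed
   place, an m such that (x/m, e^d x/m] has full density too, and these intervals
   cover a neighbourhood of n of almost twice the log-length d. *)
Lemma block_dense (d v r k s e0 Y W x N b : R) : 0 < d -> 0 < v -> 2 * v <= d ->
  0 < k -> 0 < r -> 1 <= Y -> d <= W -> r + 2 * k * expR d <= v ->
  (forall x y, 1 <= x -> x <= y -> Y <= y -> psi y - psi x <= 2 * (y - x) + k * y) ->
  (forall y, Y <= y -> 0 <= deficit (expR d) k y) ->
  (forall y, Y <= y -> e0 * y < psi (expR (6 / 5 * d) * y) - psi y) ->
  s / r * expR (6 / 5 * d) <= e0 -> s / r * expR v < v ->
  Y * expR W <= N -> N * expR W <= x / Y ->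
  deficit_sum (expR d) k x (N * expR W) - deficit_sum (expR d) k x N <= s ->
  deficit_sum (expR d) k x (x * expR W / N) -
    deficit_sum (expR d) k x (x / (N * expR W)) <= s ->
  N <= b -> b * expR (16 / 5 * d) <= N * expR W ->
  exists n, [/\ b * expR d <= n, n <= b * expR (11 / 5 * d) &
    forall w, v - d <= w -> w <= d - 2 * v ->
      2 * v / (1 + v) - (r + 2 * k * expR d) <=
      mertens (n * expR (w + v)) - mertens (n * expR w)].
Proof.
move=> d0 v0 vd k0 r0 Y1 dW; set lam := expR d; set th := r + _ => thv.
move=> loc dP ng se sv YN Nx; set T := deficit_sum lam k x => TA TB Nb bN.
have lam1 : 1 < lam by rewrite expR_gt1.
have Y0 : 0 < Y by lra.
have eW : 1 < expR W by rewrite expR_gt1; lra.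
have YN' : Y <= N by apply: le_trans YN; rewrite ler_peMr // ltW.
have N0 : 0 < N by lra.
have b0 : 0 < b by lra.
have NW0 : 0 < N * expR W by rewrite mulr_gt0 // expR_gt0.
have x0 : 0 < x.
  by have := lt_le_trans NW0 Nx; rewrite pmulr_lgt0 // invr_gt0.
have Tmono a c : 0 <= a -> a <= c -> c <= x / Y -> T a <= T c.
  exact: (le_deficit_sum Y0 dP).
have th0 : 0 <= th by rewrite /th addr_ge0 ?mulr_ge0 //; lra.
have e1 t : 0 <= t -> 1 <= expR t by move=> t0; rewrite -expR0 ler_expR.
(* This interval has log-length [6 / 5 * d], which is not a gap, so it has enough mass for
   [good_index]. *)
have [n [n0 an nb dn]] : exists n : nat, [/\ (0 < n)%N, b * expR d < n%:R,
    n%:R <= b * expR (11 / 5 * d) & deficit lam k (x / n%:R) <= r].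
  have bE : b * expR (11 / 5 * d) = expR (6 / 5 * d) * (b * expR d).
    by rewrite mulrCA -expRD; congr (_ * expR _); lra.
  have ba : b <= b * expR d by rewrite ler_peMr ?ltW ?expR_gt1.
  have ab : b * expR d <= b * expR (11 / 5 * d).
    by rewrite ler_pM2l // ler_expR; lra.
  have bx : b * expR (11 / 5 * d) <= N * expR W.
    by apply: le_trans bN; rewrite ler_pM2l // ler_expR; lra.
  have a0 : 0 < b * expR d by rewrite mulr_gt0 ?expR_gt0.
  apply: (@good_index _ _ _ _ _ _ s) => //.
    apply: le_trans TA; apply: lerB.
      by apply: Tmono => //; lra.
    by apply: Tmono; lra.
  rewrite bE mulrA; apply: le_lt_trans (ng _ _); last by lra.
  by rewrite ler_wpM2r // ltW.
have n0' : 0 < n%:R :> R by rewrite ltr0n.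
exists n%:R; split => //; first exact: ltW.
move: (n%:R) n0' an nb dn => {n0}n n0 an nb dn w w1 w2.
have nNW : n <= N * expR W.
  by apply: le_trans nb (le_trans _ bN); rewrite ler_pM2l // ler_expR; lra.
have bn : b <= n by apply/ltW/(le_lt_trans _ an); rewrite ler_peMr ?ltW ?expR_gt1.
pose y := x / n; have y0 : 0 < y by rewrite divr_gt0.
have Yy : Y <= y.
  rewrite ler_pdivlMr // mulrC -ler_pdivlMr //; exact: le_trans Nx.
(* For [m] in [(y e^t, y e^(t+v)]], [x / m] lies between [n e^(-t-v)] and [n e^(-t)]. The last two
   conditions on [t] then put [(n e^w, n e^(w+v)]] inside [(x / m, lam * x / m]]. *)
have [t [t1 t2 t3 t4]] : exists t, [/\ 0 <= t, t <= d - v, - t <= w & t <= d - w - 2 * v].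
  case: (leP w 0) => w0; [exists (- w)|exists (d - w - 2 * v)]; split; lra.
have [m [m0 am mb dm]] : exists m : nat, [/\ (0 < m)%N, y * expR t < m%:R,
    m%:R <= y * expR (t + v) & deficit lam k (x / m%:R) <= r].
  have ya : y <= y * expR t by rewrite ler_peMr ?(ltW y0) ?e1.
  have ab : y * expR t <= y * expR (t + v) by rewrite ler_pM2l // ler_expR; lra.
  have bl : y * expR (t + v) <= lam * y.
    by rewrite mulrC ler_pM2r // ler_expR; lra.
  (* [(y, lam * y]] lies in the widened reflected window, so [TB] bounds the deficits met there. *)
  have hA : x / (N * expR W) <= y by rewrite ler_pM2l // lef_pV2 ?posrE.
  have lW : lam <= expR W by rewrite ler_expR.
  have hB : lam * y <= x * expR W / N.
    rewrite mulrAC [X in _ <= X]mulrC; apply: ler_pM => //; try lra.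
    by rewrite ler_pM2l // lef_pV2 ?posrE //; lra.
  have hC : x * expR W / N <= x / Y.
    rewrite -mulrA ler_pM2l // ler_pdivrMr // mulrC ler_pdivlMr //.
    by rewrite mulrC.
  apply: (@good_index _ _ _ _ _ _ s) => //; first lra.
    apply: le_trans TB; apply: lerB.
      by apply: Tmono => //; lra.
    by apply: Tmono; rewrite ?divr_ge0 ?(ltW x0) ?(ltW NW0) //; lra.
  have := psi_full lam1 k0 Y1 loc Yy dn ya ab bl; rewrite -/th; apply: lt_le_trans.
  have ev : 1 + v <= expR v by exact: expR_ge1Dx.
  rewrite expRD (mulrA y); set a := y * expR t in ya *.
  have a0 : 0 < a by lra.
  have : th * y <= v * a by apply: ler_pM => //; lra.
  have : s / r * expR v * a < v * a by rewrite ltr_pM2r.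
  have : (1 + v) * a <= expR v * a by rewrite ler_pM2r.
  lra.
have m0' : 0 < m%:R :> R by rewrite ltr0n.
move: (m%:R) m0' am mb dm => {m0}m m0 am mb dm.
pose z := x / m.
have xE : x = n * y by rewrite /y mulrC divfK ?gt_eqF.
have z1 : z <= n * expR w.
  rewrite /z ler_pdivrMr // [X in X <= _]xE -mulrA ler_pM2l //.
  apply: (@le_trans _ _ (expR w * (y * expR t))); last by rewrite ler_pM2l ?expR_gt0 ?ltW.
  by rewrite mulrCA -expRD ler_peMr ?(ltW y0) // e1; lra.
have z2 : n * expR (- (t + v)) <= z.
  rewrite /z [X in _ <= X / _]xE -mulrA ler_pM2l // expRN ler_pdivlMr //.
  by rewrite mulrC ler_pdivrMr ?expR_gt0.
have Yz : Y <= z.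
  apply: le_trans z2; apply: (@le_trans _ _ (n * expR (- d))); last first.
    by rewrite ler_pM2l // ler_expR; lra.
  by rewrite expRN ler_pdivlMr ?expR_gt0 //; apply/ltW/(le_lt_trans _ an);
     rewrite ler_pM2r ?expR_gt0 //; lra.
have AB : n * expR w <= n * expR (w + v) by rewrite ler_pM2l // ler_expR; lra.
have Bz : n * expR (w + v) <= lam * z.
  apply: (@le_trans _ _ (lam * (n * expR (- (t + v))))); last first.
    by rewrite ler_pM2l // expR_gt0.
  by rewrite mulrCA -expRD ler_pM2l // ler_expR; lra.
have := psi_full lam1 k0 Y1 loc Yz dm z1 AB Bz; rewrite -/th => full.
have A0 : 0 < n * expR w by rewrite mulr_gt0 // expR_gt0.
have /andP[+ _] := mertens_psi_le A0 AB; apply: le_trans.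
rewrite ler_pdivlMr; last lra.
apply: le_trans full.
move: AB; rewrite expRD (mulrA n); set A := n * expR w in z1 A0 * => AB.
have ev : 1 + v <= expR v by exact: expR_ge1Dx.
(* Amounts to [1 - e^(-v) >= v / (1 + v)]. *)
have h1 : 2 * v / (1 + v) * (A * expR v) <= 2 * (A * expR v - A).
  rewrite mulrAC ler_pdivrMr; last lra.
  have : A * (1 + v) <= A * expR v by rewrite ler_pM2l.
  nra.
have h2 : th * z <= th * (A * expR v) by rewrite ler_wpM2l //; lra.
lra.
Qed.

Lemma mertens_cells (n v c : R) (j : nat) :
  (forall i, (i < j)%N ->
     c <= mertens (n * expR (v * i.+1%:R)) - mertens (n * expR (v * i%:R))) ->
  j%:R * c <= mertens (n * expR (v * j%:R)) - mertens n.
Proof.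
elim: j => [|j IH] H; first by rewrite mul0r mulr0 expR0 mulr1 subrr.
have h1 := H j (ltnSn _); have h2 := IH (fun i ij => H i (ltnW ij)).
by rewrite -[X in X * c <= _]natr1; lra.
Qed.

(** Each of [M] consecutive blocks of log-length [16 / 5 * d] gets Mertens mass at least
    [17 / 5 * d]. The excess [M * d / 5] is more than the [2 K] that Mertens allows. Here 16/5 = 1 +
    6/5 + 1: [n] lies in the middle part, and its neighbourhood reaches almost [d] to each side. *)
Lemma no_gap (d : R) : 0 < d -> ~ gap d.
Proof.
move=> d00 gd0; have [{d00 gd0}d d0 [gd ng]] := gap_threshold d00 gd0.
have [e0 [X0 [e00 ngP]]] : exists e X, 0 < e /\
    forall y, X <= y -> e * y < psi (expR (6 / 5 * d) * y) - psi y.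
  apply: contrapT => H; apply: ng => e X e0; apply: contrapT => H'.
  apply: H; exists e, X; split => // y Xy; rewrite ltNge; apply/negP => le.
  by apply: H'; exists y.
have [K mK] := @mertens_approx R.
have K0 : 0 <= K by apply: le_trans (mK 1 (lexx _)).
(* The cell length [v] divides [d] into [S] cells and is at most both 1/20 and [d / 40]. *)
pose S := (Num.truncn (20 * d) + 40)%N.
have S40 : 40 <= S%:R :> R by rewrite ler_nat leq_addl.
have S20 : 20 * d <= S%:R.
  by rewrite natrD; have := truncnS_gt (20 * d); rewrite -natr1; lra.
pose v := d / S%:R; have v0 : 0 < v by rewrite divr_gt0 //; lra.
have vS : v * S%:R = d by rewrite /v divfK // gt_eqF //; lra.
have v20 : v <= 1 / 20 by rewrite /v ler_pdivrMr; lra.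
have vd : 40 * v <= d by rewrite -vS mulrC ler_pM2l.
pose M := (Num.truncn (10 * K / d)).+1.
have MK : 2 * K < M%:R * (d / 5).
  have : 10 * K / d < M%:R by exact: truncnS_gt.
  by rewrite ltr_pdivrMr //; lra.
pose W := M%:R * (16 / 5 * d).
have dW : d <= W.
  have : 1 <= M%:R :> R by rewrite ler1n.
  by rewrite /W; nra.
have W0 : 0 < W by lra.
pose r := v / 40; have r0 : 0 < r by rewrite divr_gt0.
(* The two bounds serve the two uses of [good_index] in [block_dense]: the first for [n], the second
   for [m]. *)
pose s := Num.min (e0 * r / expR (6 / 5 * d)) (r * v / (2 * expR v)).
have s0 : 0 < s.
  rewrite lt_min; apply/andP; split; apply: divr_gt0.
  - exact: mulr_gt0.
  - exact: expR_gt0.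
  - exact: mulr_gt0.
  - by rewrite pmulr_rgt0 ?expR_gt0.
have s1 : s / r * expR (6 / 5 * d) <= e0.
  rewrite mulrAC ler_pdivrMr // -ler_pdivlMr ?expR_gt0 //.
  by rewrite /s ge_min lexx.
have s2 : s / r * expR v < v.
  have : s <= r * v / (2 * expR v) by rewrite /s ge_min lexx orbT.
  rewrite ler_pdivlMr ?pmulr_rgt0 ?expR_gt0 // => h.
  rewrite mulrAC ltr_pdivrMr //; have : 0 < r * v by exact: mulr_gt0.
  lra.
set lam := expR d; have lam1 : 1 < lam by rewrite expR_gt1.
(* The first bound is for [good_window]; the second keeps the density loss per cell below
   [v / 20]. *)
pose k := Num.min (s / (13 * W)) (v / (80 * lam)).
have k0 : 0 < k.
  rewrite lt_min; apply/andP; split; apply: divr_gt0 => //.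
  - by rewrite pmulr_rgt0.
  - by rewrite pmulr_rgt0 ?expR_gt0.
have ks : 12 * W * k < s.
  have : k <= s / (13 * W) by rewrite /k ge_min lexx.
  rewrite ler_pdivlMr ?pmulr_rgt0 // => h.
  have : 0 < k * W by exact: mulr_gt0.
  lra.
have kv : r + 2 * k * lam <= v / 20.
  have : k <= v / (80 * lam) by rewrite /k ge_min lexx orbT.
  by rewrite ler_pdivlMr ?pmulr_rgt0 ?expR_gt0 // /r; lra.
have [Y1 Y11 loc] := psi_local k0; have [Y2 Y21 def] := deficit_ge0 lam1 k0.
pose Y := Num.max Y1 (Num.max Y2 X0).
have [YY1 YY2 YX0] : [/\ Y1 <= Y, Y2 <= Y & X0 <= Y].
  by rewrite /Y !le_max !lexx !orbT.
have {}loc x y : 1 <= x -> x <= y -> Y <= y -> psi y - psi x <= 2 * (y - x) + k * y.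
  by move=> x1 xy Yy; apply: loc => //; lra.
have {}def y : Y <= y -> 0 <= deficit lam k y by move=> Yy; apply: def; lra.
have {}ngP y : Y <= y -> e0 * y < psi (expR (6 / 5 * d) * y) - psi y.
  by move=> Yy; apply: ngP; lra.
have Yge1 : 1 <= Y by lra.
have [x [N [YN Nx TA TB]]] := good_window d0 gd k0 W0 Yge1 ks def.
have N1 : 1 <= N.
  apply: le_trans Yge1 (le_trans _ YN); rewrite ler_peMr //; first lra.
  by rewrite -expR0 ler_expR ltW.
have N0 : 0 < N by lra.
have e1 (t : R) : 0 <= t -> 1 <= expR t by move=> t0; rewrite -expR0 ler_expR.
have block i : (i < M)%N -> 17 / 5 * d <=
    mertens (N * expR (16 / 5 * d * i.+1%:R)) - mertens (N * expR (16 / 5 * d * i%:R)).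
  move=> iM; set b := N * expR (16 / 5 * d * i%:R).
  have bE : N * expR (16 / 5 * d * i.+1%:R) = b * expR (16 / 5 * d).
    by rewrite /b -(mulrA N) -expRD -natr1; congr (_ * expR _); ring.
  have Nb : N <= b.
    rewrite /b ler_peMr ?(ltW N0) // e1 // mulr_ge0 //; lra.
  have bN : b * expR (16 / 5 * d) <= N * expR W.
    rewrite -bE ler_pM2l // ler_expR /W mulrC ler_wpM2r ?ler_nat //; lra.
  have thv : r + 2 * k * expR d <= v by rewrite -/lam; lra.
  have vd2 : 2 * v <= d by lra.
  have b0 : 0 < b by lra.
  have [n [bn nb cells]] := block_dense d0 v0 vd2 k0 r0 Yge1 dW thv loc def ngP s1 s2
     YN Nx TA TB Nb bN.
  rewrite bE.
  have n0 : 0 < n by apply: lt_le_trans bn; rewrite mulr_gt0 ?expR_gt0.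
  pose n1 := n * expR (v - d).
  have n10 : 0 < n1 by rewrite mulr_gt0 ?expR_gt0.
  have SE : (2 * S - 2)%:R = 2 * S%:R - 2 :> R.
    by rewrite natrB ?natrM // leq_pmulr // /S addn_gt0 orbT.
  (* The [2 S - 2] cells run from [n e^(v-d)] to [n e^(d-v)]. Each has mass at least
     [19/10 v - v/20 = 37/20 v]. *)
  have /mertens_cells : forall j, (j < 2 * S - 2)%N -> 37 / 20 * v <=
      mertens (n1 * expR (v * j.+1%:R)) - mertens (n1 * expR (v * j%:R)).
    move=> j jS; have jS' : j%:R + 1 <= 2 * S%:R - 2 :> R.
      by rewrite -SE natr1 ler_nat.
    have j0 : 0 <= j%:R :> R by [].
    rewrite /n1 -!(mulrA n) -!expRD.
    have -> : v - d + v * j.+1%:R = (v - d + v * j%:R) + v by rewrite -natr1; ring.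
    apply: le_trans (cells _ _ _); last 2 first.
    - by have := mulr_ge0 (ltW v0) j0; lra.
    - have : v * (j%:R + 1) <= v * (2 * S%:R - 2) by rewrite ler_pM2l.
      lra.
    rewrite -/lam.
    suff : 19 / 10 * v <= 2 * v / (1 + v) by lra.
    rewrite ler_pdivlMr; last lra.
    nra.
  rewrite SE; have <- : n * expR (d - v) = n1 * expR (v * (2 * S%:R - 2)).
    by rewrite /n1 -mulrA -expRD -vS; congr (_ * expR _); ring.
  have m1 : mertens b <= mertens n1.
    apply: le_mertens; first exact: ltW.
    rewrite /n1 expRD expRN mulrA ler_pdivlMr ?expR_gt0 //.
    apply: le_trans bn _; rewrite ler_peMr ?(ltW n0) //.
    by rewrite -expR0 ler_expR ltW.
  have m2 : mertens (n * expR (d - v)) <= mertens (b * expR (16 / 5 * d)).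
    apply: le_mertens; first by rewrite mulr_ge0 ?expR_ge0 ?ltW.
    apply: (@le_trans _ _ (b * expR (11 / 5 * d) * expR (d - v))).
      by rewrite ler_pM2r ?expR_gt0.
    by rewrite -mulrA -expRD ler_pM2l // ler_expR; lra.
  have -> : (2 * S%:R - 2) * (37 / 20 * v) = 37 / 10 * (v * S%:R) - 37 / 10 * v by field.
  by rewrite vS; move: m1 m2 vd; lra.
have := mertens_cells block.
rewrite (mulrC _ M%:R) -/W.
have NW1 : 1 <= N * expR W.
  by apply: le_trans N1 _; rewrite ler_peMr ?(ltW N0) // -expR0 ler_expR ltW.
have := mK _ N1; have := mK _ NW1; rewrite lnM ?posrE ?expR_gt0 // expRK.
rewrite !ler_norml => /andP[_ h1] /andP[h2 _] h3.
rewrite /W in h1 h3; lra.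
Qed.

(** An interval without prime powers has no [psi] mass at all, so failure for arbitrarily large [x]
    would make [d] a gap. *)
Lemma prime_power_between (d : R) : 0 < d ->
  exists X : R, forall x, X <= x -> exists p k : nat,
    [/\ prime p, (0 < k)%N, x < (p ^ k)%:R & (p ^ k)%:R <= expR d * x].
Proof.
move=> d0; apply: contrapT => H; apply: (no_gap d0) => e X e0.
apply: contrapT => H'; apply: H; exists (Num.max X 0) => x.
rewrite ge_max => /andP[Xx x0]; apply: contrapT => H''; apply: H'; exists x => //.
have xx : x <= expR d * x by rewrite ler_peMl // -expR0 ler_expR ltW.
apply: (@le_trans _ _ 0); last by rewrite mulr_ge0 // ltW.
apply: le_trans (ler_ssum_itv (G := fun=> 0) x0 xx _) _; last first.
  have z w : \ssum_(n <= w) (0 : R) = 0 by rewrite big1.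
  by rewrite !z subrr.
move=> n n0 xn nx; case: (eqVneq (mangoldt n : R) 0) => [-> //|].
move=> /mangoldt_neq0[p [k [pp k0 nE]]]; case: H''; exists p, k.
by rewrite -nE.
Qed.

End Contradiction.

(** * The asymptotic bounds *)

Lemma f_cycle_near (R : realType) (e : nat) (eps : R) : e = 1%N \/ e = 2 -> 0 < eps ->
  \forall r \near \oo, (f r (cycle_graph (2 * (e + e).+1)))%:R <=
    (2 + eps) * (r%:R : R) `^ (e%:R / e.+1%:R).
Proof.
move=> e12 eps0; have e0 : 0 < e%:R :> R by rewrite ltr0n; case: e12 => ->.
(* A field whose order is at most [e^d] times [r ^ (1 / (e + 1))] then loses only a factor
   [1 + eps / 2] in the [e]-th power. *)
pose d := ln (1 + eps / 2) / e%:R.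
have d0 : 0 < d by rewrite divr_gt0 // ln_gt0 // ltrDl divr_gt0.
have dE : expR d ^+ e = 1 + eps / 2.
  by rewrite -expRM_natr /d divfK ?gt_eqF // lnK // posrE addr_gt0 ?divr_gt0.
have [X XP] := prime_power_between d0.
have [Y0 YX] : 0 <= Num.max X 0 /\ X <= Num.max X 0 by rewrite !le_max !lexx orbT.
set Y := Num.max X 0 in Y0 YX.
near=> r.
pose rho := (r%:R : R) `^ (e.+1%:R^-1).
have rho0 : 0 <= rho by exact: powR_ge0.
have rhoE : rho ^+ e.+1 = r%:R.
  by rewrite -powR_mulrn // -powRrM mulVf ?pnatr_eq0 // powRr1.
have Xrho : X <= rho.
  apply: le_trans YX _; rewrite -(@ler_pXn2r _ e.+1) ?nnegrE // rhoE.
  near: r; exact: nbhs_infty_ger.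
have [p [k [pp k0 rq qr]]] := XP _ Xrho.
have [F _ cF] := PrimePowerField pp k0.
have rF : (r <= #|F| ^ e.+1)%N.
  rewrite -(ler_nat R) natrX cF -rhoE; apply: lerXn2r; rewrite ?nnegrE ?ler0n //; exact: ltW.
apply: (@le_trans _ _ (2 * #|F| ^ e)%N%:R).
  by rewrite ler_nat; exact: f_cycle_le.
rewrite natrM natrX cF; apply: (@le_trans _ _ (2 * (expR d * rho) ^+ e)).
  by rewrite ler_pM2l // lerXn2r ?nnegrE // mulr_ge0 ?expR_ge0.
rewrite exprMn dE -[rho ^+ e]powR_mulrn // -powRrM [_^-1 * _]mulrC.
by rewrite mulrA; apply: ler_wpM2r; [exact: powR_ge0|clear -eps0; lra].
Unshelve. all: by end_near.
Qed.

Lemma f_cycle_asymptotic (R : realType) (e : nat) : e = 1%N \/ e = 2 ->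
  exists h : nat -> R,
    h =o_\oo (fun r : nat => (r%:R : R) `^ (e%:R / e.+1%:R)) /\
    forall r : nat, (0 < r)%N -> (f r (cycle_graph (2 * (e + e).+1)))%:R <=
      2 * (r%:R : R) `^ (e%:R / e.+1%:R) + h r.
Proof.
move=> e12; pose g (r : nat) : R := r%:R `^ (e%:R / e.+1%:R).
(* The excess is cut off at 0, since nothing prevents it from being negative of the order of [g]. *)
pose h r : R := Num.max 0 ((f r (cycle_graph (2 * (e + e).+1)))%:R - 2 * g r).
exists h; split => [|r _]; last by rewrite /h -/(g r) -lerBlDl le_max lexx orbT.
apply/eqoP => eps eps0; near=> r.
have g0 : 0 <= g r by exact: powR_ge0.
rewrite ger0_norm ?le_max ?lexx // ger0_norm //.
rewrite /h ge_max mulr_ge0 ?(ltW eps0) //= lerBlDl -mulrDl.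
near: r; exact: f_cycle_near.
Unshelve. all: by end_near.
Qed.

Theorem theorem1p5 (R : realType) :
  (exists h : nat -> R,
      h =o_\oo (fun r : nat => (r%:R : R) `^ (1 / 2)) /\
      forall r : nat, (0 < r)%N ->
        (f r (cycle_graph 6))%:R <= 2 * (r%:R : R) `^ (1 / 2) + h r)
  /\
  (exists h : nat -> R,
      h =o_\oo (fun r : nat => (r%:R : R) `^ (2 / 3)) /\
      forall r : nat, (0 < r)%N ->
        (f r (cycle_graph 10))%:R <= 2 * (r%:R : R) `^ (2 / 3) + h r).
Proof.
split; first exact: (@f_cycle_asymptotic R 1 (or_introl erefl)).
exact: (@f_cycle_asymptotic R 2 (or_intror erefl)).
Qed.
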